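(* Let $n\ge3$, let $B_{1/e}\subseteq\mathbb R^n$ be the ball of radius $1/e$ centered at $0$, and for $\delta\in(-1,1)$ set $$u_\delta(x)=(-\ln|x|)^\delta,\qquad b_\delta(x)=-\frac{\delta x}{|x|^2\ln|x|},\qquad d_\delta(x)=\frac{\delta(\delta-1)}{|x|^2\ln^2|x|}+\frac{\delta(n-2)}{|x|^2\ln|x|}.$$ Then $u_\delta\in W^{1,2}(B_{1/e})$, $b_\delta\in L^{n,q}(B_{1/e})$ and $d_\delta\in L^{\frac n2,q}(B_{1/e})$ for every $q>1$, and $u_\delta$ solves both equations $$-\Delta u_\delta-\operatorname{div}(b_\delta u_\delta)=0\qquad\text{and}\qquad-\Delta u_\delta+d_\delta u_\delta=0\qquad\text{in }B_{1/e}.$$ Moreover $u_\delta\equiv1$ on $\partial B_{1/e}$; if $\delta>0$ then $u_\delta(x)\to\infty$ as $|x|\to0$, while if $\delta<0$ then $u_\delta(x)\to0$ as $|x|\to0$ and $u_\delta$ does not vanish identically close to $0$. Consequently, for the operators $-\Delta u-\operatorname{div}(bu)$ and $-\Delta u+du$, assuming for some $q>1$ that $b\in L^{n,q}$, respectively $d\in L^{\frac n2,q}$, with $\|b\|_{n,q}$, respectively $\|d\|_{\frac n2,q}$, as small as we want, is not enough to guarantee that subsolutions that are bounded on the boundary are bounded above (maximum principle), that subsolutions are locally bounded above (Moser's estimate), or that nonnegative supersolutions $u$ satisfy $\left(⨍_{B_r}u^a\right)^{1/a}\le C\inf_{B_{r/2}}u$ on balls $B_r$ centered at $0$, for some $a>0$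 and $C<\infty$ (reverse Moser estimate).
   Context: For measurable $h$ on an open set $\Omega$, $h^*(\tau)=\inf\{t>0:|\{x\in\Omega:|h(x)|>t\}|\le\tau\}$ and for $0<p<\infty$, $\|h\|_{L^{p,q}(\Omega)}=\left(\int_0^\infty(\tau^{1/p}h^*(\tau))^q\frac{d\tau}{\tau}\right)^{1/q}$ if $0<q<\infty$, $\|h\|_{L^{p,\infty}(\Omega)}=\sup_{\tau>0}\tau^{1/p}h^*(\tau)$; for vector valued $h$ use $|h|$. Solutions are weak: $u\in W^{1,2}(\Omega)$ solves $-\Delta u-\operatorname{div}(bu)+du=0$ in $\Omega$ if $\int_\Omega\nabla u\cdot\nabla\phi+u\,b\cdot\nabla\phi+du\phi=0$ for all $\phi\in C_c^\infty(\Omega)$; sub- and supersolutions are defined with $\le0$ and $\ge0$ respectively, for all $0\le\phi\in C_c^\infty(\Omega)$. Suprema and infima are essential; $⨍_Bh=\frac1{|B|}\int_Bh$. *)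

(* Defs.v *)
(* R^n is the row-vector space 'rV[R]_n. *)
From HB Require Import structures.
From mathcomp Require Import all_boot all_order all_algebra.
From mathcomp Require Import all_classical all_reals all_analysis.
Set Implicit Arguments.
Unset Strict Implicit.
Unset Printing Implicit Defensive.
Import Order.TTheory GRing.Theory Num.Theory.
Import numFieldNormedType.Exports.
Local Open Scope classical_set_scope.
Local Open Scope ring_scope.

(* Row vectors carry the sigma-algebra generated by the coordinates, exactly as
   the library does for tuples; for the reals it is the Borel sigma-algebra. *)
Definition measure_row_display : measure_display -> measure_display.
Proof. exact. Qed.

Section measurable_row.
Context {d : measure_display} {T : sigmaRingType d} (n : nat).

Let coord : 'I_n -> 'rV[T]_n -> T := fun i x => x ord0 i.

Let row_set0 : g_sigma_preimage coord set0.
Proof. exact: sigma_algebra0. Qed.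

Let row_setC A : g_sigma_preimage coord A -> g_sigma_preimage coord (~` A).
Proof. exact: sigma_algebraC. Qed.

Let row_bigcup (F : _^nat) : (forall i, g_sigma_preimage coord (F i)) ->
  g_sigma_preimage coord (\bigcup_i (F i)).
Proof. exact: sigma_algebra_bigcup. Qed.

HB.instance Definition _ := @isMeasurable.Build (measure_row_display d)
  'rV[T]_n (g_sigma_preimage coord) row_set0 row_setC row_bigcup.

End measurable_row.

Lemma measurable_coord d (T : sigmaRingType d) n (i : 'I_n) :
  measurable_fun [set: 'rV[T]_n] (fun x => x ord0 i).
Proof.
move=> _ Y mY; rewrite setTI; apply: sub_sigma_algebra => /=.
rewrite -bigcup_seq/=; exists i => /=; first by rewrite mem_index_enum.
by exists Y => //; rewrite setTI.
Qed.

Lemma measurable_fun_rowP d1 d2 (T1 : measurableType d1)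
    (T2 : measurableType d2) n (f : T1 -> 'rV[T2]_n) :
  measurable_fun [set: T1] f <->
  forall i, measurable_fun [set: T1] (fun x => f x ord0 i).
Proof.
split=> [mf i|mf].
  exact: (measurableT_comp (measurable_coord i) mf).
move=> _ A mA; rewrite setTI.
have : preimage_set_system [set: T1] f measurable `<=` measurable.
  rewrite /measurable/= -g_sigma_preimage_comp; apply: smallest_sub.
    exact: sigma_algebra_measurable.
  case: n f mf {A mA} => [|n] f mf; first by rewrite big_ord0.
  rewrite -bigcup_mkord_ord; apply: bigcup_sub => i Ii.
  by move=> A [B mB <-]; exact: mf.
by apply; exists A => //; rewrite setTI.
Qed.

Section lebesgue_row_step.
Context {R : realType} (n : nat).

Definition row_cons (p : R * 'rV[R]_n) : 'rV[R]_n.+1 := row_mx p.1%:M p.2.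

Lemma measurable_row_cons : measurable_fun setT row_cons.
Proof.
apply/measurable_fun_rowP => i.
case: (split_ordP (i : 'I_(1 + n))) => j ->.
  rewrite (_ : (fun _ => _) = fst); first exact: measurable_fst.
  apply/funext => p; rewrite /row_cons (row_mxEl p.1%:M p.2 ord0 j) mxE.
  by rewrite !ord1 eqxx mulr1n.
rewrite (_ : (fun _ => _) = (fun x : 'rV[R]_n => x ord0 j) \o snd).
  exact: (measurableT_comp (measurable_coord j) measurable_snd).
by apply/funext => p; rewrite /row_cons (row_mxEr p.1%:M p.2 ord0 j).
Qed.

Variable mu : {sigma_finite_measure set 'rV[R]_n -> \bar R}.

Definition lebesgue_row_step : set 'rV[R]_n.+1 -> \bar R :=
  pushforward (@lebesgue_measure R \x mu)%E row_cons.

Let measurable_preimage_row_cons A :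
  measurable A -> measurable (row_cons @^-1` A).
Proof. by move=> mA; rewrite -[X in measurable X]setTI; exact: measurable_row_cons. Qed.

Let step0 : lebesgue_row_step set0 = 0%E.
Proof. by rewrite /lebesgue_row_step /pushforward preimage_set0 measure0. Qed.

Let step_ge0 A : (0 <= lebesgue_row_step A)%E.
Proof. by rewrite /lebesgue_row_step /pushforward measure_ge0. Qed.

Let step_sigma_additive : semi_sigma_additive lebesgue_row_step.
Proof.
move=> F mF tF mUF; rewrite /lebesgue_row_step /pushforward preimage_bigcup.
apply: measure_semi_sigma_additive.
- by move=> k; exact: measurable_preimage_row_cons.
- apply/trivIsetP => /= i j _ _ ij; rewrite -preimage_setI.
  by move/trivIsetP : tF => /(_ _ _ _ _ ij) ->//; rewrite preimage_set0.
- by rewrite -preimage_bigcup; exact: measurable_preimage_row_cons.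
Qed.

HB.instance Definition _ := isMeasure.Build _ _ _ lebesgue_row_step
  step0 step_ge0 step_sigma_additive.

Let row_uncons (x : 'rV[R]_n.+1) : R * 'rV[R]_n :=
  (x ord0 ord0, \row_j x ord0 (lift ord0 j)).

Let row_consK : cancel row_cons row_uncons.
Proof.
move=> [a x]; rewrite /row_uncons /row_cons/=; congr pair.
  have -> : ord0 = lshift n ord0 :> 'I_(1 + n) by exact/val_inj.
  by rewrite (row_mxEl a%:M x) mxE eqxx mulr1n.
apply/rowP => j; rewrite mxE.
have -> : lift ord0 j = rshift 1 j :> 'I_(1 + n) by exact/val_inj.
by rewrite (row_mxEr a%:M x).
Qed.

Let measurable_row_uncons : measurable_fun setT row_uncons.
Proof.
apply/measurable_fun_pairP; split; first exact: measurable_coord.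
apply/measurable_fun_rowP => j.
rewrite (_ : (fun _ => _) = (fun x : 'rV[R]_n.+1 => x ord0 (lift ord0 j))).
  exact: measurable_coord.
by apply/funext => x /=; rewrite mxE.
Qed.

Let step_sigma_finite : sigma_finite setT lebesgue_row_step.
Proof.
have /sigma_finiteP[F [TF ndF Foo]] := sigma_finiteT (@lebesgue_measure R).
have /sigma_finiteP[G [TG ndG Goo]] := sigma_finiteT mu.
exists (fun k => row_uncons @^-1` (F k `*` G k)).
  rewrite -preimage_bigcup -[LHS](preimage_setT row_uncons); congr (_ @^-1` _).
  apply/esym; rewrite -subTset => -[a x] _.
  have [k _ Fka] : (\bigcup_k F k) a by rewrite -TF.
  have [l _ Glx] : (\bigcup_k G k) x by rewrite -TG.
  exists (maxn k l) => //; split=> /=.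
    by move: a Fka; exact/subsetPset/ndF/leq_maxl.
  by move: x Glx; exact/subsetPset/ndG/leq_maxr.
move=> k; have [mF Fkoo] := Foo k; have [mG Gkoo] := Goo k; split.
  by rewrite -[X in measurable X]setTI; apply: measurable_row_uncons => //;
    exact: measurableX.
rewrite /lebesgue_row_step /pushforward -comp_preimage.
rewrite (_ : row_uncons \o row_cons = idfun) ?preimage_id; last first.
  exact/funext/row_consK.
by rewrite product_measure1E// lte_mul_pinfty// ge0_fin_numE.
Qed.

HB.instance Definition _ := Measure_isSigmaFinite.Build _ _ _
  lebesgue_row_step step_sigma_finite.

End lebesgue_row_step.

(* Lebesgue measure on R^n as the n-fold product of Lebesgue measure on R. *)
Fixpoint lebesgue_row (R : realType) (n : nat) :
    {sigma_finite_measure set 'rV[R]_n -> \bar R} :=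
  match n with
  | 0%N => \d_(0 : 'rV[R]_0)
  | m.+1 => lebesgue_row_step (lebesgue_row R m)
  end.
Arguments lebesgue_row {R n}.

Section definitions.
Context {R : realType} {n : nat}.
Implicit Types (Omega B : set 'rV[R]_n) (u phi d : 'rV[R]_n -> R)
  (b G : 'rV[R]_n -> 'rV[R]_n).

Local Notation mu := (@lebesgue_row R n).

Definition dot (x y : 'rV[R]_n) : R := \sum_i x ord0 i * y ord0 i.

(* The library norm on 'rV[R]_n is the sup norm. *)
Definition enorm (x : 'rV[R]_n) : R := Num.sqrt (dot x x).

Definition eball (r : R) : set 'rV[R]_n := [set x | enorm x < r].

Local Open Scope ereal_scope.

Definition rearrangement Omega (h : 'rV[R]_n -> R) (tau : R) : \bar R :=
  ereal_inf (EFin @` [set t : R | (0 < t)%R /\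
    mu (Omega `&` [set x | (t < `|h x|)%R]) <= tau%:E]).

(* The second exponent ranges over (0, +oo]. *)
Definition lorentz_norm (p : R) (q : \bar R) Omega (h : 'rV[R]_n -> R) :
    \bar R :=
  let g tau := (tau `^ p^-1)%:E * rearrangement Omega h tau in
  match q with
  | s%:E => (\int[lebesgue_measure]_(tau in `]0%R, +oo[%classic)
              (g tau `^ s * (tau^-1)%:E)) `^ s^-1
  | _ => ereal_sup (g @` `]0%R, +oo[%classic)
  end.

Definition in_lorentz (p : R) (q : \bar R) Omega (h : 'rV[R]_n -> R) :=
  measurable_fun Omega h /\ lorentz_norm p q Omega h < +oo.

Definition in_lorentz_vec (p : R) (q : \bar R) Omega b :=
  measurable_fun Omega b /\ lorentz_norm p q Omega (enorm \o b) < +oo.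

Definition in_L2 Omega (h : 'rV[R]_n -> R) :=
  measurable_fun Omega h /\ \int[mu]_(x in Omega) (h x ^+ 2)%:E < +oo.

Local Close Scope ereal_scope.

Definition partial (i : 'I_n) (f : 'rV[R]_n -> R) : 'rV[R]_n -> R :=
  fun x => 'D_(delta_mx ord0 i) f x.

Definition grad (f : 'rV[R]_n -> R) (x : 'rV[R]_n) : 'rV[R]_n :=
  \row_i partial i f x.

Definition smooth (f : 'rV[R]_n -> R) : Prop :=
  forall s : seq 'I_n, let g := foldr partial f s in
    continuous g /\ forall i x, derivable g x (delta_mx ord0 i).

Definition test_function Omega phi : Prop :=
  smooth phi /\ exists K : set 'rV[R]_n,
    [/\ compact K, K `<=` Omega & forall x, ~ K x -> phi x = 0].

(* u is in W^{1,2}(Omega) with weak gradient G. *)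
Definition W12_grad Omega u G : Prop :=
  [/\ in_L2 Omega u, forall i, in_L2 Omega (fun x => G x ord0 i) &
    forall phi i, test_function Omega phi ->
      \int[mu]_(x in Omega) (u x * partial i phi x) =
      - \int[mu]_(x in Omega) (G x ord0 i * phi x)].

Definition W12 Omega u : Prop := exists G, W12_grad Omega u G.

(* The closure of C_c^oo(Omega) in W^{1,2}(Omega). *)
Definition W12_0 Omega u : Prop :=
  exists2 G, W12_grad Omega u G & forall e : R, 0 < e ->
    exists2 phi, test_function Omega phi &
      (\int[mu]_(x in Omega)
        ((phi x - u x) ^+ 2 + enorm (grad phi x - G x) ^+ 2)%:E < e%:E)%E.

(* The operator is - Delta u - div (b u) + d u.  Integrability of the
   integrand is demanded explicitly because the library integral is total. *)
Definition weak_integrand b d u G phi : 'rV[R]_n -> R := fun x =>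
  dot (G x) (grad phi x) + u x * dot (b x) (grad phi x) + d x * u x * phi x.

Definition weak_solution Omega b d u : Prop :=
  exists2 G, W12_grad Omega u G & forall phi, test_function Omega phi ->
    mu.-integrable Omega (EFin \o weak_integrand b d u G phi) /\
    \int[mu]_(x in Omega) weak_integrand b d u G phi x = 0.

Definition weak_subsolution Omega b d u : Prop :=
  exists2 G, W12_grad Omega u G & forall phi, test_function Omega phi ->
    (forall x, 0 <= phi x) ->
    mu.-integrable Omega (EFin \o weak_integrand b d u G phi) /\
    \int[mu]_(x in Omega) weak_integrand b d u G phi x <= 0.

Definition weak_supersolution Omega b d u : Prop :=
  exists2 G, W12_grad Omega u G & forall phi, test_function Omega phi ->
    (forall x, 0 <= phi x) ->
    mu.-integrable Omega (EFin \o weak_integrand b d u G phi) /\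
    0 <= \int[mu]_(x in Omega) weak_integrand b d u G phi x.

(* For Sobolev functions, |u| <= M on the boundary of Omega means that
   (|u| - M)^+ lies in W^{1,2}_0(Omega). *)
Definition bounded_on_boundary Omega u : Prop :=
  exists M : R, W12_0 Omega (fun x => Num.max (`|u x| - M) 0).

Definition bounded_above Omega u : Prop :=
  exists M : R, {ae mu, forall x, Omega x -> u x <= M}.

Definition locally_bounded_above Omega u : Prop :=
  forall x, Omega x -> exists2 r : R, 0 < r &
    bounded_above (Omega `&` [set y | enorm (y - x) < r]) u.

Definition ess_inf_on B u : \bar R :=
  ereal_sup [set y : \bar R | {ae mu, forall x, B x -> (y <= (u x)%:E)%E}].

Definition reverse_moser (a C r : R) u : Prop :=
  ((((fine (mu (eball r)))^-1)%:E *
     \int[mu]_(x in eball r) (u x `^ a)%:E) `^ a^-1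
   <= C%:E * ess_inf_on (eball (r / 2)) u)%E.

Definition u_log (delta : R) (x : 'rV[R]_n) : R := (- ln (enorm x)) `^ delta.

Definition b_log (delta : R) (x : 'rV[R]_n) : 'rV[R]_n :=
  - ((delta / (enorm x ^+ 2 * ln (enorm x))) *: x).

Definition d_log (delta : R) (x : 'rV[R]_n) : R :=
  delta * (delta - 1) / (enorm x ^+ 2 * ln (enorm x) ^+ 2) +
  delta * (n%:R - 2) / (enorm x ^+ 2 * ln (enorm x)).

End definitions.

(* Main.v *)
Require Import Defs.
From HB Require Import structures.
From mathcomp Require Import all_boot all_order all_algebra.
From mathcomp Require Import all_classical all_reals all_analysis.
From mathcomp Require Import measurable_realfun.
From mathcomp Require Import ring lra.
Set Implicit Arguments.
Unset Strict Implicit.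
Unset Printing Implicit Defensive.
Import Order.TTheory GRing.Theory Num.Theory.
Import numFieldNormedType.Exports.
Local Open Scope classical_set_scope.
Local Open Scope ring_scope.

(** For u = (-ln|x|)^delta one has u b_delta = - grad u and d_delta u = Delta u away
    from the origin, and |u|, |grad u|, |Delta u| are bounded by a multiple of
    |x|^-2, which is integrable near 0 because n >= 3.  The weak formulations
    follow by integrating by parts on lines parallel to the axes: almost all of
    them miss the origin, so the singularity contributes nothing.
    The coefficients are at most A / (|x|^m (-ln|x|)) with m = 1, 2 and A of the
    order of |delta|; their rearrangement is then A tau^(-m/n) / (c - ln(tau)/n) up
    to a constant, whence an L^(n/m,q) quasinorm of order A for every q > 1.
    Small delta > 0 refutes the two upper bounds and small delta < 0 the reverse
    Moser estimate.  That u - 1 lies in W^{1,2}_0 is shown by replacing |x|^2 by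
    |x|^2 + eps in u - 1, which makes it positive only on a compact subset of the
    ball, and composing with a smooth version of the positive part. *)

(** * Topology and measurability on row vectors *)

Section measurable_row_open.
Context {R : realType} {n : nat}.
Implicit Types (U : set 'rV[R]_n) (f : 'rV[R]_n -> R).

(** Calculus is carried out in [s = |x|^2], a polynomial, so the norm itself is never
    differentiated. The radius 1/e means [s < expR (-2)], that is [- ln |x| > 1]: powers with
    exponent at most 1 are then dominated by the logarithm itself, and [r * - ln r] is increasing,
    which makes the bounds on the coefficients radially decreasing. Lebesgue measure is an iterated
    product, so volumes of cubes are computed and balls are only compared with cubes; this costs
    constants. The condition q > 1 enters through the convergence at 0 of the integral of
    [(c - ln(tau)/n)^(-q) / tau]. For the first operator the two fluxes cancel pointwise;
    integration by parts is needed there only to identify the weak gradient. Smoothness of the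
    approximants concerns all iterated partial derivatives, so it is proved for a class of formulas
    closed under differentiation. The smooth positive part is [w * expR (- (k * w)^-1)]: its slope
    stays in [0, 1], so the approximants obey the bounds of [u] uniformly and dominated convergence
    gives the limit in W^{1,2}. *)

Lemma row_nbhsP (x : 'rV[R]_n) (A : set 'rV[R]_n) :
  nbhs x A <-> exists2 e : R, 0 < e &
    forall y : 'rV[R]_n, (forall i, `|x ord0 i - y ord0 i| < e) -> A y.
Proof.
split=> [/nbhs_ballP[e /= e0 eA]|[e e0 eA]].
  exists e => // y xy; apply: eA; split=> // i j.
  by rewrite ord1; exact: xy.
apply/nbhs_ballP; exists e => //= y [_ xy]; apply: eA => i; exact: xy.
Qed.

Let box (q : 'rV[rat]_n) (m : nat) : set 'rV[R]_n :=
  [set x | forall i, `|x ord0 i - ratr (q ord0 i)| < m.+1%:R^-1].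

Let measurable_box q m : measurable (box q m).
Proof.
rewrite (_ : box q m = \big[setI/setT]_(i < n)
    [set x : 'rV[R]_n | `|x ord0 i - ratr (q ord0 i)| < m.+1%:R^-1]).
  apply: bigsetI_measurable => i _.
  rewrite (_ : mkset _ = (fun x : 'rV[R]_n => x ord0 i) @^-1`
      `](ratr (q ord0 i) - m.+1%:R^-1), (ratr (q ord0 i) + m.+1%:R^-1)[%classic).
    by rewrite -[X in measurable X]setTI; exact: measurable_coord.
  by apply/seteqP; split=> x /=; rewrite in_itv/= ltr_distl.
apply/seteqP; split=> x /=.
  by move=> xb; elim/big_ind : _ => // i _ /=; exact: xb.
move=> xb i; have {xb} : x \in \big[setI/setT]_(i < n)
    [set x : 'rV[R]_n | `|x ord0 i - ratr (q ord0 i)| < m.+1%:R^-1] by rewrite inE.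
by rewrite (bigD1 i)//= => /set_mem[].
Qed.

(** The sigma-algebra is generated by the coordinates, so second countability has to be used: an
    open set is the union of the countably many boxes with rational centre and side [2 / m.+1] that
    it contains. *)
Lemma open_measurable_row U : open U -> measurable U.
Proof.
move=> oU; pose F (qm : 'rV[rat]_n * nat) :=
  if `[< box qm.1 qm.2 `<=` U >] then box qm.1 qm.2 else set0.
rewrite (_ : U = \bigcup_qm F qm).
  apply: countable_bigcupT_measurable; first exact: countableP.
  by move=> [q m]; rewrite /F; case: ifP.
apply/seteqP; split=> [x Ux|x [[q m] _]]; last first.
  by rewrite /F /=; case: ifPn => // /asboolP; apply.
have /row_nbhsP[e e0 eU] : nbhs x U by exact: open_nbhs_nbhs.
have [m me] : exists m, m.+1%:R^-1 < e / 2.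
  near \oo => m; exists m; near: m.
  have /cvgrPdist_lt/(_ (e / 2)) := @cvg_harmonic R.
  rewrite divr_gt0//= => /(_ isT); apply: filterS => m.
  by rewrite /harmonic/= sub0r normrN ger0_norm.
have ex i : exists q : rat, `|x ord0 i - ratr q| < m.+1%:R^-1.
  have /rat_in_itvoo[q] : x ord0 i - m.+1%:R^-1 < x ord0 i + m.+1%:R^-1.
    by rewrite ltrBlDr -addrA ltrDl addr_gt0.
  rewrite in_itv/= => /andP[q1 q2]; exists q.
  by rewrite ltr_distlC q1 q2.
exists (\row_i projT1 (cid (ex i)), m) => //.
have xb : box (\row_i projT1 (cid (ex i))) m x.
  by move=> i; rewrite mxE; exact: (projT2 (cid (ex i))).
rewrite /F /=; case: ifPn => // /asboolPn[] y yb; apply: eU => i.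
rewrite (le_lt_trans (ler_distD (ratr ((\row_i projT1 (cid (ex i))) ord0 i)) _ _))//.
have := ltrD (xb i) (yb i); rewrite [X in _ + X < _ -> _]distrC => /lt_trans; apply.
by rewrite (splitr e) ltrD.
Unshelve. all: by end_near. Qed.

Lemma open_continuous_measurable_row U f :
  open U -> {in U, continuous f} -> measurable_fun U f.
Proof.
move=> oU cf; apply: (measurability _ (RGenOInfty.measurableE R)).
move=> _ [_ [a ->] <-]; apply: open_measurable_row.
rewrite openE => x [Ux fx].
have cfx : {for x, continuous f} by apply: cf; rewrite inE.
apply: filterI; first exact: open_nbhs_nbhs.
by apply: cfx; apply: open_nbhs_nbhs; split => //; exact: interval_open.
Qed.

Lemma continuous_measurable_row f : continuous f -> measurable_fun setT f.
Proof.
by move=> cf; apply: open_continuous_measurable_row => //; exact: openT.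
Qed.

End measurable_row_open.

(** * Volumes of cubes and the null set at the origin *)

Lemma row_cons0 (R : realType) n (p : R * 'rV[R]_n) : row_cons p ord0 ord0 = p.1.
Proof.
have -> : ord0 = lshift n ord0 :> 'I_(1 + n) by exact/val_inj.
by rewrite (row_mxEl p.1%:M p.2) mxE eqxx mulr1n.
Qed.

Lemma row_cons_lift (R : realType) n (p : R * 'rV[R]_n) j :
  row_cons p ord0 (lift ord0 j) = p.2 ord0 j.
Proof.
have -> : lift ord0 j = rshift 1 j :> 'I_(1 + n) by exact/val_inj.
by rewrite (row_mxEr p.1%:M p.2).
Qed.

Lemma forall_ord_recl n (P : 'I_n.+1 -> Prop) :
  (forall i, P i) <-> P ord0 /\ forall j, P (lift ord0 j).
Proof.
split=> [H|[P0 PS] i]; first by split.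
by case: (unliftP ord0 i) => [j ->|->].
Qed.

Lemma in_big_setI T n (P : 'I_n -> set T) (x : T) :
  (\big[setI/setT]_(i < n) P i) x <-> forall i, P i x.
Proof.
split=> [|Px]; last by elim/big_ind : _ => // A B Ax Bx; split.
by move=> + i; rewrite (bigD1 i)//= => -[].
Qed.

(** Cubes, unlike balls, are products under [row_cons], so their volume follows by induction on the
    dimension; balls are measured by comparison with them. *)
Definition cube {R : realType} {n} (r : R) : set 'rV[R]_n :=
  [set x | forall i, `|x ord0 i| < r].

Lemma row_cons_cube (R : realType) n (r : R) :
  @row_cons R n @^-1` cube r = `](- r), r[%classic `*` cube r.
Proof.
apply/seteqP; split => -[a x] /=; rewrite in_itv/= -ltr_norml.
  by move/forall_ord_recl => [+ H]; rewrite row_cons0; split => // j;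
    have := H j; rewrite row_cons_lift.
move=> [ar xr]; apply/forall_ord_recl; split; first by rewrite row_cons0.
by move=> j; rewrite row_cons_lift.
Qed.

Lemma open_cube (R : realType) n (r : R) : open (@cube R n r).
Proof.
rewrite (_ : cube r = \big[setI/setT]_(i < n) [set x : 'rV[R]_n | `|x ord0 i| < r]).
  elim/big_ind : _ => [|A B|i _]; [exact: openT|exact: openI|].
  apply: (@open_comp _ _ (fun x : 'rV[R]_n => `|x ord0 i|) [set y | y < r]).
    move=> x _; apply: (@continuous_comp _ _ _ (fun x : 'rV[R]_n => x ord0 i)).
      exact: coord_continuous.
    exact: norm_continuous.
  exact: open_lt.
by apply/seteqP; split => x; [move=> xr; apply/in_big_setI|move/in_big_setI].
Qed.

Lemma measurable_cube (R : realType) n (r : R) : measurable (@cube R n r).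
Proof. by apply: open_measurable_row; exact: open_cube. Qed.

Lemma lebesgue_rowS (R : realType) n (A : set 'rV[R]_n.+1) :
  lebesgue_row A = (lebesgue_measure \x lebesgue_row)%E (@row_cons R n @^-1` A).
Proof. by []. Qed.

Lemma lebesgue_row_cube (R : realType) n (r : R) : 0 <= r ->
  lebesgue_row (@cube R n r) = ((2 * r) ^+ n)%:E.
Proof.
move=> r0; elim: n => [|n IH].
  by rewrite /= diracE mem_set// => -[].
rewrite lebesgue_rowS row_cons_cube product_measure1E//; last exact: measurable_cube.
transitivity (lebesgue_measure (`](- r)%R, r[%classic : set R) * ((2 * r) ^+ n)%:E)%E.
  by rewrite IH.
rewrite lebesgue_measure_itv/= lte_fin -EFinB.
case: ifPn => [_|]; first by rewrite -EFinM exprS; congr (_%:E); ring.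
rewrite -leNgt => ?; have -> : r = 0 by lra.
by rewrite mul0e mulr0 exprS mul0r.
Qed.

Lemma closed_row_set1 (R : realType) n (x : 'rV[R]_n) : closed [set x].
Proof. by apply: compact_closed; [exact: norm_hausdorff|exact: compact_set1]. Qed.

Lemma measurable_row_set1 (R : realType) n (x : 'rV[R]_n) : measurable [set x].
Proof.
rewrite -[X in measurable X]setCK; apply: measurableC.
by apply: open_measurable_row; apply: closed_openC; exact: closed_row_set1.
Qed.

(** In dimension 0 the measure is the Dirac mass at the only point. Otherwise the origin lies in
    cubes of side [Num.min e 1], and a number at most 1 dominates its positive powers. *)
Lemma lebesgue_row_set0 (R : realType) n : (0 < n)%N ->
  lebesgue_row [set (0 : 'rV[R]_n)] = 0%E.
Proof.
move=> n0; apply/eqP; rewrite eq_le measure_ge0 andbT.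
apply/lee_addgt0Pr => e e0; rewrite add0e.
pose r := Num.min e 1 / 2.
have r0 : 0 < r by rewrite divr_gt0// lt_min e0/=.
apply: (@le_trans _ _ (lebesgue_row (@cube R n r))).
  apply: le_measure; rewrite ?inE.
  - exact: measurable_row_set1.
  - exact: measurable_cube.
  - by move=> _ -> i; rewrite mxE normr0.
rewrite (lebesgue_row_cube _ (ltW r0)) lee_fin.
case: n n0 => // n _; rewrite exprS /r [2 * _]mulrC divfK//.
have m1 : Num.min e 1 <= 1 by rewrite ge_min lexx orbT.
have m0 : 0 < Num.min e 1 by rewrite lt_min e0/=.
rewrite (@le_trans _ _ (Num.min e 1))//; last by rewrite ge_min lexx.
by rewrite ler_piMr ?exprn_ile1// ltW.
Qed.

Lemma measurable_invr (R : realType) : measurable_fun setT (@GRing.inv R).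
Proof.
rewrite -(setvU [set (0 : R)]); apply/measurable_funU => //; first exact: measurableC.
split; last exact: measurable_fun_set1.
apply: open_continuous_measurable_fun.
  by apply: closed_openC; exact: closed_eq.
by move=> x; rewrite inE/= => /eqP x0; exact: inv_continuous.
Qed.

(** * The Euclidean norm, balls, and integrability of [|x|^-2] *)

Section euclidean_norm.
Context {R : realType} {n : nat}.
Implicit Types (x : 'rV[R]_n) (r : R).
Local Notation mu := (@lebesgue_row R n).

Lemma dot_sqr x : dot x x = \sum_i x ord0 i ^+ 2.
Proof. by rewrite /dot; apply: eq_bigr => i _; rewrite expr2. Qed.

Lemma dot_ge0 x : 0 <= dot x x.
Proof. by rewrite dot_sqr sumr_ge0// => i _; exact: sqr_ge0. Qed.

Lemma enorm_ge0 x : 0 <= enorm x.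
Proof. exact: sqrtr_ge0. Qed.

Lemma enorm_sqr x : enorm x ^+ 2 = dot x x.
Proof. by rewrite sqr_sqrtr// dot_ge0. Qed.

Lemma coord_enorm x i : `|x ord0 i| <= enorm x.
Proof.
rewrite -(@ler_pXn2r _ 2) ?nnegrE ?enorm_ge0// enorm_sqr dot_sqr real_normK ?num_real//.
by rewrite (bigD1 i)//= lerDl sumr_ge0// => j _; exact: sqr_ge0.
Qed.

Lemma enorm0 : enorm (0 : 'rV[R]_n) = 0.
Proof. by rewrite /enorm /dot big1 ?sqrtr0// => i _; rewrite mxE mul0r. Qed.

Lemma enorm_eq0 x : (enorm x == 0) = (x == 0).
Proof.
apply/eqP/eqP => [x0|->]; last exact: enorm0.
apply/rowP => i; apply/eqP; rewrite mxE -normr_eq0 eq_le normr_ge0 andbT.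
by rewrite -x0 coord_enorm.
Qed.

Lemma enorm_gt0 x : (0 < enorm x) = (x != 0).
Proof. by rewrite lt_def enorm_ge0 enorm_eq0 andbT. Qed.

Lemma dot_continuous : continuous (fun x => dot x x).
Proof.
rewrite (_ : (fun x => _) = \sum_(i < n) fun x : 'rV[R]_n => x ord0 i * x ord0 i).
  elim/big_ind : _ => [|f g cf cg|i _].
  - exact: cst_continuous.
  - by move=> x; apply: continuousD; [exact: cf|exact: cg].
  - by move=> x; apply: continuousM; exact: coord_continuous.
by apply/funext => x; rewrite fct_sumE.
Qed.

Lemma enorm_continuous : continuous (@enorm R n).
Proof.
move=> x; apply: (@continuous_comp _ _ _ (fun x : 'rV[R]_n => dot x x)).
  exact: dot_continuous.
exact: sqrt_continuous.
Qed.

Lemma measurable_enorm : measurable_fun setT (@enorm R n).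
Proof. exact: continuous_measurable_row enorm_continuous. Qed.

Lemma open_eball r : open (@eball R n r).
Proof.
apply: (@open_comp _ _ (@enorm R n) [set y | y < r]); last exact: open_lt.
by move=> x _; exact: enorm_continuous.
Qed.

Lemma measurable_eball r : measurable (@eball R n r).
Proof. by apply: open_measurable_row; exact: open_eball. Qed.

Lemma eball_sub_cube r : @eball R n r `<=` cube r.
Proof. by move=> x xr i; apply: le_lt_trans xr; exact: coord_enorm. Qed.

(** Dividing by [n.+1] avoids a square root: [n < n.+1 ^ 2] is enough, and [n = 0] is covered. *)
Lemma cube_sub_eball r : 0 < r -> @cube R n (r / n.+1%:R) `<=` eball r.
Proof.
move=> r0 x xr; rewrite /eball/= -(@ltr_pXn2r _ 2) ?nnegrE ?enorm_ge0 ?ltW//.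
rewrite enorm_sqr dot_sqr (@le_lt_trans _ _ (\sum_(i < n) (r / n.+1%:R) ^+ 2))//.
  apply: ler_sum => i _; rewrite -(real_normK (num_real (x ord0 i))).
  by rewrite ler_pXn2r ?nnegrE ?divr_ge0// ltW//; exact: xr.
rewrite sumr_const card_ord -[ltLHS]mulr_natr expr_div_n -mulrA gtr_pMr ?exprn_gt0//.
rewrite mulrC ltr_pdivrMr ?exprn_gt0// mul1r -natrX ltr_nat expnS expn1.
exact: leq_pmulr.
Qed.

Lemma eball_le r : 0 <= r -> (mu (eball r) <= ((2 * r) ^+ n)%:E)%E.
Proof.
move=> r0; rewrite -lebesgue_row_cube//; apply: le_measure; rewrite ?inE.
- exact: measurable_eball.
- exact: measurable_cube.
- exact: eball_sub_cube.
Qed.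

Lemma eball_gt0 r : 0 < r -> (0 < mu (eball r))%E.
Proof.
move=> r0; apply: (@lt_le_trans _ _ (mu (cube (r / n.+1%:R)))).
  by rewrite lebesgue_row_cube ?divr_ge0 ?ltW// lte_fin exprn_gt0// mulr_gt0// divr_gt0.
apply: le_measure; rewrite ?inE.
- exact: measurable_cube.
- exact: measurable_eball.
- exact: cube_sub_eball.
Qed.

Lemma eball_fin_num r : mu (eball r) \is a fin_num.
Proof.
rewrite ge0_fin_numE ?measure_ge0//; have [r0|r0] := leP 0 r.
  by apply: (le_lt_trans (eball_le r0)); rewrite ltry.
rewrite (_ : eball r = set0) ?measure0//.
by apply/seteqP; split => // x; rewrite /eball/= => /(le_lt_trans (enorm_ge0 x)); rewrite ltNge ltW.
Qed.

(** Decomposition of the punctured unit ball into dyadic shells [2^-(k+1) <= |x| < 2^-k]. *)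
Lemma inv_enorm_sqr_dyadic x : x != 0 -> eball 1 x ->
  exists k, cube (2 ^- k) x /\ (enorm x ^+ 2)^-1 <= 4 ^+ k.+1.
Proof.
move=> x0 x1; have ex : exists k, 2 ^- k.+1 <= enorm x.
  near \oo => k; exists k; near: k.
  have : (fun k => (2^-1 : R) ^+ k) @ \oo --> (0 : R).
    by apply: cvg_expr; rewrite ger0_norm ?invr_ge0// invf_lt1// ltr1n.
  move=> /cvgrPdist_lt/(_ (enorm x)); rewrite enorm_gt0 x0 => /(_ isT).
  apply: filterS => k; rewrite sub0r normrN ger0_norm ?exprn_ge0 ?invr_ge0// => /ltW.
  rewrite exprVn; apply: le_trans.
  by rewrite lef_pV2 ?posrE ?exprn_gt0// exprS ler_peMl ?exprn_ge0// ler1n.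
(* Minimality of [k] gives [|x| < 2^-k]; for [k = 0] this is the hypothesis that [x] lies in the
   unit ball. *)
exists (ex_minn ex); case: ex_minnP => k kx kmin; split.
  apply: eball_sub_cube; rewrite /eball/=; case: k kx kmin => [|k] kx kmin.
    by rewrite expr0 invr1.
  by rewrite ltNge; apply/negP => /kmin; rewrite ltnn.
rewrite -[4 ^+ _]invrK lef_pV2 ?posrE ?invr_gt0 ?exprn_gt0// ?enorm_gt0//.
rewrite (_ : 4 = 2 ^+ 2)//; last by rewrite -natrX.
by rewrite exprAC -exprVn ler_pXn2r ?nnegrE ?invr_ge0 ?exprn_ge0 ?enorm_ge0.
Unshelve. all: by end_near. Qed.

(** The integrand is dominated by the sum over [k] of [4^(k+1)] on the cube of half-side [2^-k].
    Each term integrates to [4^(k+1) * 2^n * 2^(-n k)], which for [n >= 3] is at most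
    [8 * 2^n / 2^(k+1)], a summable sequence. *)
Lemma integral_inv_enorm_sqr : (3 <= n)%N ->
  (\int[mu]_(x in eball 1) ((enorm x ^+ 2)^-1)%:E < +oo)%E.
Proof.
move=> n3; pose f k x : \bar R := (4 ^+ k.+1 * \1_(cube (2 ^- k)) x)%:E.
have f0 k x : (0 <= f k x)%E by rewrite lee_fin mulr_ge0.
have mf k : measurable_fun (eball 1) (f k).
  apply/measurable_EFinP; apply: measurable_funM => //.
  by apply: measurable_indic; exact: measurable_cube.
apply: (@le_lt_trans _ _ (\int[mu]_(x in eball 1) \sum_(k <oo) f k x)%E).
  apply: ge0_le_integral => //.
  - exact: measurable_eball.
  - by move=> x _; rewrite lee_fin invr_ge0 exprn_ge0// enorm_ge0.
  - apply/measurable_EFinP; apply: measurable_funTS.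
    apply: (@measurableT_comp _ _ _ _ _ _ (@GRing.inv R)).
      exact: measurable_invr.
    by apply: measurable_funX; exact: measurable_enorm.
  - exact: ge0_emeasurable_sum.
  - move=> x x1; have [->|x0] := eqVneq x 0.
      by rewrite enorm0 expr0n/= invr0; exact: nneseries_ge0.
    have [k [kx xk]] := inv_enorm_sqr_dyadic x0 x1.
    apply: (@le_trans _ _ (\sum_(0 <= i < k.+1) f i x)%E); last first.
      exact: nneseries_lim_ge.
    rewrite big_nat_recr//= -[leLHS]add0e leeD ?sume_ge0//.
    by rewrite /f indicE mem_set// mulr1 lee_fin.
rewrite integral_nneseries//; last exact: measurable_eball.
apply: (@le_lt_trans _ _ (\sum_(k <oo) ((8 * 2 ^+ n) / (2 ^ k.+1)%:R)%:E)%E); last first.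
  by apply: (le_lt_trans (epsilon_trick0 _ _)); rewrite ?ltry// mulr_ge0// exprn_ge0.
apply: lee_nneseries => [k _ _|k _]; first exact: integral_ge0.
apply: (@le_trans _ _ (\int[mu]_x f k x)%E).
  apply: ge0_subset_integral => //; first exact: measurable_eball.
  apply/measurable_EFinP; apply: measurable_funM => //.
  by apply: measurable_indic; exact: measurable_cube.
rewrite /f (integralZl_indic measurableT (fun=> cube (2 ^- k)))//; last exact: measurable_cube.
rewrite integral_indic//; last exact: measurable_cube.
rewrite setIT [X in (_ * X <= _)%E](_ : _ = mu (cube (2 ^- k)))//.
rewrite lebesgue_row_cube ?invr_ge0 ?exprn_ge0// -EFinM lee_fin.
rewrite exprMn -exprVn exprAC.
  rewrite (@le_trans _ _ (4 ^+ k.+1 * (2 ^+ n * 8^-1 ^+ k)))//.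
    rewrite ler_pM2l ?exprn_gt0// ler_pM2l ?exprn_gt0// lerXn2r ?nnegrE ?exprn_ge0 ?invr_ge0//.
    rewrite (_ : 8^-1 = 2^-1 ^+ 3); last by field.
    by rewrite ler_wiXn2l ?invr_ge0// invf_le1// ler1n.
  rewrite (_ : 8^-1 = 2^-1 * 4^-1); last by field.
  rewrite exprMn !exprVn natrX !exprS le_eqVlt; apply/orP; left; apply/eqP.
  by field; rewrite !expf_neq0 ?pnatr_eq0.
by rewrite ltNge exprn_ge0.
Qed.

End euclidean_norm.

(** * Slices parallel to the axes and integrals of partial derivatives *)

Lemma row_continuousP (R : realType) n (T : topologicalType) (c : T -> 'rV[R]_n) (t : T) :
  (forall i, {for t, continuous (fun s => c s ord0 i)}) -> {for t, continuous c}.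
Proof.
move=> cc A /row_nbhsP[e e0 eA].
have : \forall s \near t, forall i, `|c t ord0 i - c s ord0 i| < e.
  apply: filter_forall => i; exact: (@cvgrPdist_lt _ _ _ _ _ _ _).1 (cc i) e e0.
by apply: filterS => s cs; exact: eA.
Qed.

Lemma row_cons_slicel (R : realType) n (y : 'rV[R]_n) : continuous (fun a => row_cons (a, y)).
Proof.
move=> a; apply: row_continuousP => i; case: (unliftP ord0 i) => [j ->|->].
  rewrite (_ : (fun s => _) = cst (y ord0 j)); first exact: cst_continuous.
  by apply/funext => q; rewrite row_cons_lift.
rewrite (_ : (fun s => _) = id); first exact: cvg_id.
by apply/funext => q; rewrite row_cons0.
Qed.

Lemma row_cons_slicer (R : realType) n (a : R) : continuous (fun y : 'rV[R]_n => row_cons (a, y)).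
Proof.
move=> y; apply: row_continuousP => i; case: (unliftP ord0 i) => [j ->|->].
  rewrite (_ : (fun s => _) = fun x : 'rV[R]_n => x ord0 j); first exact: coord_continuous.
  by apply/funext => q; rewrite row_cons_lift.
rewrite (_ : (fun s => _) = cst a); first exact: cst_continuous.
by apply/funext => q; rewrite row_cons0.
Qed.

(** Both difference quotients are literally the same function of [h]. This transports directional
    derivatives between the whole space and its slices. *)
Lemma is_derive_line (R : realType) (U V : normedModType R) (f : V -> R)
    (c : U -> V) (a u : U) (v : V) (d : R) :
  (forall h : R, c (h *: u + a) = h *: v + c a) ->
  is_derive (c a) v f d <-> is_derive a u (f \o c) d.
Proof.
move=> cE; have E : (fun h : R => h^-1 *: ((f \o c \o shift a) (h *: u) - (f \o c) a)) =
    (fun h => h^-1 *: ((f \o shift (c a)) (h *: v) - f (c a))).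
  by apply/funext => h /=; rewrite cE.
by split=> -[dv vd]; split; move: dv vd; rewrite /derivable /derive E.
Qed.

Lemma row_cons_addl (R : realType) n (y : 'rV[R]_n) (a h : R) :
  row_cons (h *: (1 : R) + a, y) = h *: delta_mx ord0 ord0 + row_cons (a, y).
Proof.
apply/rowP => i; rewrite [RHS]mxE; case: (unliftP ord0 i) => [j ->|->].
  by rewrite !row_cons_lift !mxE/= mulr0 add0r.
by rewrite !row_cons0 !mxE/= -[h *: 1]/(h * 1) !mulr1.
Qed.

Lemma row_cons_addr (R : realType) n (y : 'rV[R]_n) j (a h : R) :
  row_cons (a, h *: delta_mx ord0 j + y) = h *: delta_mx ord0 (lift ord0 j) + row_cons (a, y).
Proof.
apply/rowP => i; rewrite [RHS]mxE; case: (unliftP ord0 i) => [k ->|->].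
  by rewrite !row_cons_lift !mxE/= (inj_eq lift_inj).
by rewrite !row_cons0 !mxE/= mulr0 add0r.
Qed.

Lemma integral_derive_compact_support (R : realType) (f g : R -> R) (r : R) : 0 < r ->
  (forall t : R, is_derive t (1 : R) f (g t)) -> continuous g ->
  (forall t, r <= `|t| -> f t = 0) -> (forall t, r <= `|t| -> g t = 0) ->
  (\int[lebesgue_measure]_t (g t)%:E = 0)%E.
Proof.
move=> r0 df cg f0 g0; have rr : - r < r by lra.
transitivity (\int[lebesgue_measure]_(t in `[(- r)%R, r]) (g t)%:E)%E.
  rewrite [RHS]integral_mkcond; apply: eq_integral => t _.
  rewrite patchE; case: ifPn => // /negP tr; rewrite g0// leNgt; apply/negP => tr'.
  by apply: tr; rewrite inE/= in_itv/= -ler_norml ltW.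
have cf : continuous f.
  move=> t; apply/differentiable_continuous/derivable1_diffP.
  by have [] := df t.
rewrite (continuous_FTC2 rr _ _ (F := f)).
- by rewrite (f0 r) ?ler_norm// (f0 (- r)) ?normrN ?ler_norm// subee.
- by apply: continuous_subspaceT.
- split; first by move=> t _; have [] := df t.
  + exact/cvg_at_right_filter/cf.
  + exact/cvg_at_left_filter/cf.
- by move=> t _; rewrite derive1E; have [] := df t.
Qed.

Lemma integrable_row_cons (R : realType) n (g : 'rV[R]_n.+1 -> R) :
  lebesgue_row.-integrable setT (EFin \o g) ->
  (lebesgue_measure \x lebesgue_row)%E.-integrable setT (EFin \o g \o @row_cons R n).
Proof.
move=> /integrableP[mg goo]; apply/integrableP; split.
  by apply: measurableT_comp => //; exact: measurable_row_cons.
move: goo; rewrite /= ge0_integral_pushforward//.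
- exact: measurable_row_cons.
- by apply/measurable_EFinP; apply: measurableT_comp => //; exact/measurable_EFinP.
Qed.

Lemma integral_row_cons (R : realType) n (g : 'rV[R]_n.+1 -> R) :
  lebesgue_row.-integrable setT (EFin \o g) ->
  (\int[lebesgue_row]_x (g x)%:E =
   \int[lebesgue_measure \x lebesgue_row]_z (g (row_cons z))%:E)%E.
Proof.
move=> ig; rewrite /= (@integral_pushforward _ _ _ _ _ _ _ _ setT (EFin \o g))//.
- exact: measurable_row_cons.
- exact: measurable_int ig.
- exact: integrable_row_cons.
Qed.

Lemma continuous_cube_bounded (R : realType) n (g : 'rV[R]_n -> R) (r : R) :
  continuous g -> (forall x, ~ cube r x -> g x = 0) ->
  exists2 M : R, 0 <= M & forall x, `|g x| <= M.
Proof.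
move=> cg g0.
have cK : compact [set x : 'rV[R]_n | forall i, `[- r, r]%classic (x ord0 i)].
  by apply: (@rV_compact _ _ (fun=> `[- r, r]%classic)) => _; exact: segment_compact.
have /compact_bounded[M [_ Mg]] : compact (g @` [set x : 'rV[R]_n | forall i, `[- r, r]%classic (x ord0 i)]).
  by apply: continuous_compact => //; exact: continuous_subspaceT.
exists (`|M| + 1); first by rewrite addr_ge0.
move=> x; have [xr|xr] := pselect (cube r x); last by rewrite g0// normr0 addr_ge0.
apply: Mg; first by rewrite ltr_pwDr// ler_norm.
by exists x => // i /=; rewrite in_itv/= -ler_norml ltW.
Qed.

Lemma le_integrable_bound (R : realType) n (D : set 'rV[R]_n) (g h : 'rV[R]_n -> R) :
  measurable D -> measurable_fun D g -> (forall x, D x -> `|g x| <= h x) ->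
  lebesgue_row.-integrable D (EFin \o h) -> lebesgue_row.-integrable D (EFin \o g).
Proof.
move=> mD mg gh ih; apply: le_integrable ih => //; first exact/measurable_EFinP.
by move=> x Dx /=; rewrite lee_fin (le_trans (gh _ Dx))// ler_norm.
Qed.

Lemma continuous_cube_integrable (R : realType) n (g : 'rV[R]_n -> R) (r : R) :
  continuous g -> (forall x, ~ cube r x -> g x = 0) ->
  lebesgue_row.-integrable setT (EFin \o g).
Proof.
move=> cg g0; have [M M0 gM] := continuous_cube_bounded cg g0.
apply: (@le_integrable_bound _ _ _ _ (fun x => M * \1_(cube r) x)) => //.
- exact: continuous_measurable_row.
- move=> x _; rewrite indicE; have [xr|xr] := pselect (cube r x).
    by rewrite mem_set// mulr1.
  by rewrite g0// normr0 mulr_ge0.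
have mc := @measurable_cube R n r.
apply/integrableP; split.
  by apply/measurable_EFinP; apply: measurable_funM => //; exact: measurable_indic.
rewrite (eq_integral (fun x => (M * \1_(cube r) x)%:E)); last first.
  by move=> x _ /=; rewrite ger0_norm// mulr_ge0.
rewrite (integralZl_indic measurableT (fun=> cube r))//; last first.
  by move=> /(le_lt_trans M0); rewrite ltxx.
rewrite integral_indic// setIT lte_mul_pinfty// ?lee_fin//.
have [r0|r0] := leP 0 r.
  by rewrite [ltLHS](_ : _ = lebesgue_row (@cube R n r))// lebesgue_row_cube// ltry.
(* A negative [r] makes the cube empty in positive dimension, but in dimension 0 the condition on
   the coordinates is void and the cube is the whole space. *)
have [n0|n0] := posnP n; last first.
  rewrite (_ : cube r = set0) ?measure0//; apply/seteqP; split => // x xr.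
  by have := xr (Ordinal n0) => /(le_lt_trans (normr_ge0 _)); rewrite ltNge ltW.
apply: (@le_lt_trans _ _ (lebesgue_row (@cube R n 1))).
  by apply: le_measure; rewrite ?inE//; [exact: measurable_cube|move=> x _ i; have := ltn_ord i; rewrite {2}n0].
by rewrite lebesgue_row_cube// ltry.
Qed.

(** Fubini after splitting off the first coordinate: if [i] is that coordinate, the inner integral
    is one-dimensional and vanishes by the fundamental theorem of calculus; otherwise the slices
    fall under the induction hypothesis. *)
Lemma integral_partial_eq0 (R : realType) n (i : 'I_n) (f g : 'rV[R]_n -> R) (r : R) :
  0 < r -> (forall x, is_derive x (delta_mx ord0 i) f (g x)) -> continuous g ->
  (forall x, ~ cube r x -> f x = 0) -> (forall x, ~ cube r x -> g x = 0) ->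
  (\int[lebesgue_row]_x (g x)%:E = 0)%E.
Proof.
move=> r0; elim: n i f g => [[//]|n IH] i f g df cg f0 g0.
have ig := continuous_cube_integrable cg g0.
rewrite integral_row_cons//; have ig' := integrable_row_cons ig.
case: (unliftP ord0 i) => [j|] ij.
  rewrite -(integral12_prod_meas1 ig') integral0_eq// => a _.
  apply: (IH j (fun y => f (row_cons (a, y))) (fun y => g (row_cons (a, y)))).
  - move=> y; apply: (@is_derive_line _ _ _ f (fun y => row_cons (a, y)) y
      (delta_mx ord0 j) (delta_mx ord0 (lift ord0 j)) (g (row_cons (a, y))) _).1.
      by move=> h; exact: row_cons_addr.
    by have := df (row_cons (a, y)); rewrite ij; exact.
  - move=> y; apply: (@continuous_comp _ _ _ (fun y => row_cons (a, y))).
      exact: row_cons_slicer.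
    exact: cg.
  - move=> y yr; apply: f0 => /forall_ord_recl[_ H]; apply: yr => k.
    by have := H k; rewrite row_cons_lift.
  - move=> y yr; apply: g0 => /forall_ord_recl[_ H]; apply: yr => k.
    by have := H k; rewrite row_cons_lift.
rewrite -(integral21_prod_meas1 ig') integral0_eq// => y _.
apply: (@integral_derive_compact_support _ (fun a => f (row_cons (a, y))) _ r) => //.
- move=> a; apply: (@is_derive_line _ _ _ f (fun a => row_cons (a, y)) a
    (1 : R) (delta_mx ord0 ord0) (g (row_cons (a, y))) _).1.
    by move=> h; exact: row_cons_addl.
  by have := df (row_cons (a, y)); rewrite ij; exact.
- move=> a; apply: (@continuous_comp _ _ _ (fun a => row_cons (a, y))).
    exact: row_cons_slicel.
  exact: cg.
- move=> a ar; apply: f0 => /forall_ord_recl[+ _].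
  by rewrite row_cons0 ltNge ar.
- move=> a ar; apply: g0 => /forall_ord_recl[+ _].
  by rewrite row_cons0 ltNge ar.
Qed.

Lemma ae_neq (d : measure_display) (T : measurableType d) (R : realType)
    (mu : {measure set T -> \bar R}) (x0 : T) (P : T -> Prop) :
  measurable [set x0] -> mu [set x0] = 0%E -> (forall x, x <> x0 -> P x) ->
  {ae mu, forall x, P x}.
Proof.
move=> m0 mu0 HP; exists [set x0]; split => // x /= nP.
by apply: contrapT => /HP.
Qed.

(* Almost every line parallel to a coordinate axis misses the origin, so the
   singular point does not disturb the fundamental theorem of calculus. *)
Lemma integral_partial_punctured_eq0 (R : realType) n (i : 'I_n) (f g : 'rV[R]_n -> R) (r : R) :
  (1 < n)%N -> 0 < r ->
  (forall x, x != 0 -> is_derive x (delta_mx ord0 i) f (g x)) ->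
  (forall x, x != 0 -> {for x, continuous g}) ->
  (forall x, ~ cube r x -> f x = 0) -> (forall x, ~ cube r x -> g x = 0) ->
  lebesgue_row.-integrable setT (EFin \o g) ->
  (\int[lebesgue_row]_x (g x)%:E = 0)%E.
Proof.
case: n i f g => [//|n] i f g n1 r0 df cg f0 g0 ig.
rewrite integral_row_cons//; have ig' := integrable_row_cons ig.
have rowa (a : R) (y : 'rV[R]_n) : a != 0 -> row_cons (a, y) != 0.
  by apply: contra => /eqP/rowP/(_ ord0); rewrite row_cons0 mxE /= => ->.
have rowy (a : R) (y : 'rV[R]_n) : y != 0 -> row_cons (a, y) != 0.
  apply: contra => /eqP/rowP H; apply/eqP/rowP => j.
  by have := H (lift ord0 j); rewrite row_cons_lift !mxE.
case: (unliftP ord0 i) => [j|] ij.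
  rewrite -(integral12_prod_meas1 ig') (ae_eq_integral (cst 0%E)) ?integral0//.
    exact: measurable_fubini_F ig'.
  apply: (@ae_neq _ _ _ lebesgue_measure (0 : R)); [exact: measurable_set1|exact: lebesgue_measure_set1|].
  move=> a /eqP a0 _.
  apply: (@integral_partial_eq0 _ _ j (fun y => f (row_cons (a, y)))
    (fun y => g (row_cons (a, y))) r) => //.
  - move=> y; apply: (@is_derive_line _ _ _ f (fun y => row_cons (a, y)) y
      (delta_mx ord0 j) (delta_mx ord0 (lift ord0 j)) (g (row_cons (a, y))) _).1.
      by move=> h; exact: row_cons_addr.
    by have := df (row_cons (a, y)) (rowa _ _ a0); rewrite ij; exact.
  - move=> y; apply: (@continuous_comp _ _ _ (fun y => row_cons (a, y))).
      exact: row_cons_slicer.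
    exact/cg/rowa.
  - move=> y yr; apply: f0 => /forall_ord_recl[_ H]; apply: yr => k.
    by have := H k; rewrite row_cons_lift.
  - move=> y yr; apply: g0 => /forall_ord_recl[_ H]; apply: yr => k.
    by have := H k; rewrite row_cons_lift.
rewrite -(integral21_prod_meas1 ig') (ae_eq_integral (cst 0%E)) ?integral0//.
  exact: measurable_fubini_G ig'.
apply: (@ae_neq _ _ _ lebesgue_row (0 : 'rV[R]_n)); [exact: measurable_row_set1|exact: lebesgue_row_set0|].
move=> y /eqP y0 _.
apply: (@integral_derive_compact_support _ (fun a => f (row_cons (a, y))) _ r) => //.
- move=> a; apply: (@is_derive_line _ _ _ f (fun a => row_cons (a, y)) a
    (1 : R) (delta_mx ord0 ord0) (g (row_cons (a, y))) _).1.
    by move=> h; exact: row_cons_addl.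
  by have := df (row_cons (a, y)) (rowy _ _ y0); rewrite ij; exact.
- move=> a; apply: (@continuous_comp _ _ _ (fun a => row_cons (a, y))).
    exact: row_cons_slicel.
  exact/cg/rowy.
- move=> a ar; apply: f0 => /forall_ord_recl[+ _].
  by rewrite row_cons0 ltNge ar.
- move=> a ar; apply: g0 => /forall_ord_recl[+ _].
  by rewrite row_cons0 ltNge ar.
Qed.

(** * Test functions and domination by [|x|^-2] *)

Section test_functions.
Context {R : realType} {n : nat}.
Implicit Types (Omega U K : set 'rV[R]_n) (f g phi : 'rV[R]_n -> R) (r : R) (x : 'rV[R]_n).
Local Notation mu := (@lebesgue_row R n).
Local Notation e_ i := (delta_mx ord0 i : 'rV[R]_n).

Lemma measurable_fun_punctured U f : open U ->
  (forall x, U x -> x != 0 -> {for x, continuous f}) -> measurable_fun U f.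
Proof.
move=> oU cf; have oU0 : open (U `\ 0).
  apply: openI => //; apply: closed_openC; exact: closed_row_set1.
have -> : U = (U `\ 0) `|` (U `&` [set 0]) by rewrite setDE -setIUr setUC setUv setIT.
apply/measurable_funU.
- exact: open_measurable_row.
- by apply: measurableI; [exact: open_measurable_row|exact: measurable_row_set1].
- split; last by by apply: (measurable_funS _ _ (@measurable_fun_set1 _ _ _ _ (0 : 'rV[R]_n) f)) => //; exact: measurable_row_set1.
  apply: open_continuous_measurable_row => // x; rewrite inE => -[Ux /eqP x0].
  exact: cf.
Qed.

Lemma continuous_near x f g : (\near x, f x = g x) -> {for x, continuous f} -> {for x, continuous g}.
Proof.
move=> fg cf; rewrite /prop_for /continuous_at -(nbhs_singleton fg).
apply: cvg_trans cf; apply: near_eq_cvg; [exact: nbhs_filter|exact: fg].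
Qed.

(** The complement of the support is open and covers the space together with [Omega], so a local
    property has to be checked only in [Omega] and where [phi] vanishes near the point. *)
Lemma test_function_vanish Omega phi : test_function Omega phi ->
  exists2 U, open U & [/\ ~` Omega `<=` U, forall x, U x -> phi x = 0 &
    forall x, U x \/ Omega x].
Proof.
move=> [sphi [K [cK KO phi0]]]; exists (~` K).
  by apply: closed_openC; apply: compact_closed => //; exact: norm_hausdorff.
split=> [x nO Kx|x|x]; [exact/nO/KO|exact: phi0|].
by have [Kx|?] := pselect (K x); [right; exact: KO|left].
Qed.

Lemma is_derive_partial phi i x : smooth phi -> is_derive x (e_ i) phi (partial i phi x).
Proof. by move=> /(_ [::])[_ /(_ i x) dphi]; exact: derivableP. Qed.

Lemma smooth_continuous phi : smooth phi -> continuous phi.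
Proof. by move=> /(_ [::])[]. Qed.

Lemma smooth_partial_continuous phi i : smooth phi -> continuous (partial i phi).
Proof. by move=> /(_ [:: i])[]. Qed.

Lemma test_function_partial_vanish Omega phi i x : test_function Omega phi -> ~ Omega x ->
  phi x = 0 /\ partial i phi x = 0.
Proof.
move=> tphi nO; have [U oU [OU U0 _]] := test_function_vanish tphi.
split; first exact/U0/OU.
have : is_derive x (e_ i) (cst 0 : 'rV[R]_n -> R) (partial i phi x).
  apply: (@near_eq_is_derive _ _ _ phi); last first.
    by apply: is_derive_partial; case: tphi.
  by near=> y; rewrite /cst U0//; near: y; apply: open_nbhs_nbhs; split => //; exact: OU.
by move=> [_ <-]; rewrite derive_cst.
Unshelve. all: by end_near. Qed.

Lemma test_function_bounded r phi : test_function (eball r) phi ->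
  exists2 M : R, 0 <= M & forall x, `|phi x| <= M /\ forall i, `|partial i phi x| <= M.
Proof.
move=> tphi; have [sphi _] := tphi.
have H f : continuous f -> (forall x, ~ eball r x -> f x = 0) ->
    exists2 M : R, 0 <= M & forall x, `|f x| <= M.
  move=> cf f0; apply: (@continuous_cube_bounded _ _ _ r) => // x xr.
  by apply: f0 => /eball_sub_cube.
have [M0 M00 M0P] : exists2 M : R, 0 <= M & forall x, `|phi x| <= M.
  apply: H; first exact: smooth_continuous.
  move=> x xr; have [U oU [OU U0 _]] := test_function_vanish tphi.
  exact/U0/OU.
have HM i : exists M : R, 0 <= M /\ forall x, `|partial i phi x| <= M.
  have [|x xr|M M1 M2] := H (partial i phi).
  - exact: smooth_partial_continuous.
  - by have [] := test_function_partial_vanish i tphi xr.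
  - by exists M.
pose M i := projT1 (cid (HM i)).
have MP i : 0 <= M i /\ forall x, `|partial i phi x| <= M i := projT2 (cid (HM i)).
exists (M0 + \sum_i M i).
  by rewrite addr_ge0// sumr_ge0// => i _; case: (MP i).
move=> x; split; first by rewrite (le_trans (M0P x))// lerDl sumr_ge0// => i _; case: (MP i).
move=> i; rewrite (le_trans ((MP i).2 x))//.
rewrite (bigD1 i)//= addrCA lerDl addr_ge0// sumr_ge0// => j _.
by case: (MP j).
Qed.

Lemma integrable_inv_enorm_sqr r : (3 <= n)%N -> r <= 1 ->
  mu.-integrable (eball r) (fun x => ((enorm x ^+ 2)^-1)%:E).
Proof.
move=> n3 r1; apply: (@integrableS _ _ _ _ (eball 1)).
- exact: measurable_eball.
- exact: measurable_eball.
- by move=> x; rewrite /eball/= => /lt_le_trans; apply.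
apply/integrableP; split.
  apply/measurable_EFinP; apply: measurable_funTS.
  apply: (@measurableT_comp _ _ _ _ _ _ (@GRing.inv R)); first exact: measurable_invr.
  by apply: measurable_funX; exact: measurable_enorm.
rewrite (eq_integral (fun x => ((enorm x ^+ 2)^-1)%:E)); first exact: integral_inv_enorm_sqr.
by move=> x _; rewrite gee0_abs// lee_fin invr_ge0 exprn_ge0// enorm_ge0.
Qed.

Lemma integrable_le_inv_enorm_sqr r (C : R) f : (3 <= n)%N -> r <= 1 ->
  measurable_fun (eball r) f ->
  (forall x, eball r x -> x != 0 -> `|f x| <= C / enorm x ^+ 2) ->
  mu.-integrable (eball r) (EFin \o f).
Proof.
move=> n3 r1 mf fC; have mB := @measurable_eball R n r.
pose D := eball r `\ (0 : 'rV[R]_n).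
have mD : measurable D by apply: measurableD => //; exact: measurable_row_set1.
apply/integrableP; split; first exact/measurable_EFinP.
rewrite (@ge0_negligible_integral _ _ _ _ _ [set (0 : 'rV[R]_n)])//.
- apply: (@le_lt_trans _ _ (\int[mu]_(x in D) (`|C| * (enorm x ^+ 2)^-1)%:E)%E).
    apply: ge0_le_integral => //.
    - by apply: measurableT_comp => //; apply/measurable_EFinP; apply: measurable_funS mf => // x [].
    - apply/measurable_EFinP; apply: measurable_funM => //; apply: measurable_funTS.
      apply: (@measurableT_comp _ _ _ _ _ _ (@GRing.inv R)); first exact: measurable_invr.
      by apply: measurable_funX; exact: measurable_enorm.
    - move=> x [xr /eqP x0]; rewrite lee_fin (le_trans (fC _ xr x0))//.
      by rewrite ler_wpM2r ?ler_norm// invr_ge0 exprn_ge0// enorm_ge0.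
  under eq_integral do rewrite EFinM.
  have iD : mu.-integrable D (fun x => ((enorm x ^+ 2)^-1)%:E).
    by apply: integrableS (integrable_inv_enorm_sqr n3 r1) => // x [].
  by rewrite integralZl// lte_mul_pinfty ?lee_fin// integrable_lty.
- exact: measurable_row_set1.
- by apply: measurableT_comp => //; exact/measurable_EFinP.
- by apply: lebesgue_row_set0; exact: leq_trans n3.
Qed.

End test_functions.

(** * Integration by parts across an isolated singularity *)

Section punctured_parts.
Context {R : realType} {n : nat}.
Implicit Types (f g phi : 'rV[R]_n -> R) (r : R) (x : 'rV[R]_n).
Local Notation mu := (@lebesgue_row R n).
Local Notation e_ i := (delta_mx ord0 i : 'rV[R]_n).
Hypothesis n3 : (3 <= n)%N.

Lemma integrable_mul_bounded r (C M : R) f g : r <= 1 -> 0 <= M ->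
  (forall x, eball r x -> x != 0 -> {for x, continuous f}) ->
  (forall x, eball r x -> x != 0 -> `|f x| <= C / enorm x ^+ 2) ->
  continuous g -> (forall x, `|g x| <= M) ->
  mu.-integrable (eball r) (fun x => (f x * g x)%:E).
Proof.
move=> r1 M0 cf fC cg gM.
apply: (@integrable_le_inv_enorm_sqr _ _ r (`|C| * M) (fun x => f x * g x)) => //.
  apply: measurable_fun_punctured; first exact: open_eball.
  by move=> x xr x0; apply: continuousM; [exact: cf|exact: cg].
move=> x xr x0; rewrite normrM mulrAC ler_pM//.
by rewrite (le_trans (fC _ xr x0))// ler_wpM2r ?ler_norm// invr_ge0 exprn_ge0// enorm_ge0.
Qed.

(** The function [h] is the i-th partial derivative of [f * phi], so its integral over the whole
    space is zero. Nothing is assumed on [f] outside the ball: a point other than the origin lies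
    either in the ball, where the product rule applies, or in the open set [U] where [phi]
    vanishes. *)
Lemma integration_by_parts_punctured r i (C : R) f g phi : r <= 1 ->
  test_function (eball r) phi ->
  (forall x, eball r x -> x != 0 -> is_derive x (e_ i) f (g x)) ->
  (forall x, eball r x -> x != 0 -> {for x, continuous f}) ->
  (forall x, eball r x -> x != 0 -> {for x, continuous g}) ->
  (forall x, eball r x -> x != 0 -> `|f x| <= C / enorm x ^+ 2) ->
  (forall x, eball r x -> x != 0 -> `|g x| <= C / enorm x ^+ 2) ->
  [/\ mu.-integrable (eball r) (fun x => (f x * partial i phi x)%:E),
      mu.-integrable (eball r) (fun x => (g x * phi x)%:E) &
      \int[mu]_(x in eball r) (f x * partial i phi x) =
      - \int[mu]_(x in eball r) (g x * phi x)].
Proof.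
move=> r1 tphi df cf cg fC gC; have [sphi _] := tphi.
have [M M0 MP] := test_function_bounded tphi.
have mB := @measurable_eball R n r.
have i1 : mu.-integrable (eball r) (fun x => (f x * partial i phi x)%:E).
  apply: (integrable_mul_bounded r1 M0 cf fC) => //; first exact: smooth_partial_continuous.
  by move=> x; case: (MP x).
have i2 : mu.-integrable (eball r) (fun x => (g x * phi x)%:E).
  apply: (integrable_mul_bounded r1 M0 cg gC) => //; first exact: smooth_continuous.
  by move=> x; case: (MP x).
split => //; apply/eqP; rewrite -subr_eq0 opprK -RintegralD//; apply/eqP.
have [U oU [OU U0 UO]] := test_function_vanish tphi.
pose h x := f x * partial i phi x + g x * phi x.
have vanish x : ~ eball r x -> phi x = 0 /\ partial i phi x = 0.
  exact: test_function_partial_vanish.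
have U0' x : U x -> partial i phi x = 0.
  move=> Ux; rewrite /partial (@near_eq_derive _ _ _ _ (cst 0)) ?derive_cst//.
  by near=> y; rewrite U0//; near: y; exact: open_nbhs_nbhs.
have cube1 x : ~ cube 1 x -> ~ eball r x.
  by apply: contra_not => xr; apply: eball_sub_cube; apply: lt_le_trans r1.
have hE : h = h \_ (eball r).
  apply/funext => x; rewrite patchE; case: ifPn => // /negP; rewrite inE => /vanish[p0 dp0].
  by rewrite /h p0 dp0 !mulr0 addr0.
rewrite /Rintegral -/(h _) (_ : \int[_]_(x in _) _ = 0)%E//.
have ih : mu.-integrable (eball r) (EFin \o h) by exact: (integrableD mB i1 i2).
transitivity (\int[mu]_x (h x)%:E)%E.
  by rewrite integral_mkcond restrict_EFin -hE.
apply: (@integral_partial_punctured_eq0 _ _ i (fun x => f x * phi x) h 1) => //.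
- exact: leq_trans n3.
- move=> x x0; have [Ux|xr] := UO x.
    have -> : h x = 0 by rewrite /h U0// U0'// !mulr0 addr0.
    apply: (@near_eq_is_derive _ _ _ (cst 0 : 'rV[R]_n -> R)).
    by near=> y; rewrite U0 ?mulr0//; near: y; exact: open_nbhs_nbhs.
  have df' := df _ xr x0; have dphi := is_derive_partial i x sphi.
  apply: (is_derive_eq (is_deriveM df' dphi)).
  by rewrite /h /GRing.scale/= [phi x * _]mulrC.
- move=> x x0; have [Ux|xr] := UO x.
    apply: (@continuous_near _ _ _ (cst 0)); last exact: cst_continuous.
    near=> y; have Uy : U y by near: y; exact: open_nbhs_nbhs.
    by rewrite /h U0// U0'// !mulr0 addr0.
  apply: continuousD; apply: continuousM.
  + exact: cf.
  + exact: smooth_partial_continuous.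
  + exact: cg.
  + exact: smooth_continuous.
- by move=> x /cube1/vanish[-> _]; rewrite mulr0.
- by move=> x /cube1/vanish[p0 dp0]; rewrite /h p0 dp0 !mulr0 addr0.
- by have := (integrable_mkcond (EFin \o h) mB).1 ih; rewrite restrict_EFin -hE.
Unshelve. all: by end_near. Qed.

End punctured_parts.

(** * Powers of the logarithm as functions of [s = |x|^2] *)

Section log_power.
Context {R : realType}.
Implicit Types (delta s t : R).

(* With s = |x|^2 one has mlog s = - ln |x|, hence plog delta s = u_log delta x;
   plog1 and plog2 are the first two derivatives of plog in s. *)
Definition mlog s : R := - (ln s / 2).
Definition plog delta s : R := mlog s `^ delta.
Definition plog1 delta s : R := - delta * plog delta s * (2 * s * mlog s)^-1.
Definition plog2 delta s : R :=
  delta * plog delta s * (delta - 1 + 2 * mlog s) * ((2 * s * mlog s) ^+ 2)^-1.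

Lemma mlog_gt0 s : 0 < s < 1 -> 0 < mlog s.
Proof. by move=> /ln_lt0 ?; rewrite /mlog; lra. Qed.

Lemma is_derive_mlog s : 0 < s -> is_derive s (1 : R) mlog (- (2 * s)^-1).
Proof.
move=> s0; have dl := is_derive1_ln s0.
apply: (is_derive_eq (is_deriveN (is_deriveM dl (is_derive_cst (2^-1 : R) s (1 : R))))).
by rewrite /GRing.scale/= /cst mulr0 add0r invfM.
Qed.

Lemma is_derive_plog delta s : 0 < s < 1 -> is_derive s (1 : R) (plog delta) (plog1 delta s).
Proof.
move=> /andP[s0 s1]; have T0 : 0 < mlog s by rewrite mlog_gt0 ?s0.
have dT := is_derive_mlog s0.
apply: (is_derive_eq (is_derive1_comp (is_derive1_powR delta T0) dT)).
rewrite /GRing.scale/= /plog1 /plog powRB ?powRr1 ?ltW//; last by apply/implyP => _; rewrite gt_eqF.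
by field; rewrite !gt_eqF.
Qed.

Lemma is_derive_plog1 delta s : 0 < s < 1 -> is_derive s (1 : R) (plog1 delta) (plog2 delta s).
Proof.
move=> /[dup] s01 /andP[s0 s1]; have T0 : 0 < mlog s by rewrite mlog_gt0 ?s0.
have dT := is_derive_mlog s0; have dU := is_derive_plog delta s01.
have d1 := is_deriveM (is_deriveM (is_derive_cst (2 : R) s (1 : R)) (is_derive_id s (1 : R))) dT.
have n0 : ((cst 2 : R -> R) * id * mlog) s != 0 by rewrite !mulf_neq0 ?gt_eqF.
have d2 := is_deriveV n0 d1.
apply: (is_derive_eq (is_deriveM (is_deriveM (is_derive_cst (- delta) s (1 : R)) dU) d2)).
rewrite /GRing.scale/= /plog2 /plog1 /cst/= !fctE /=.
by field; rewrite !gt_eqF.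
Qed.

Lemma is_derive1_continuous (f : R -> R) s df : is_derive s (1 : R) f df -> {for s, continuous f}.
Proof. by move=> [df' _]; apply/differentiable_continuous/derivable1_diffP. Qed.

Lemma continuous_plog2 delta s : 0 < s < 1 -> {for s, continuous (plog2 delta)}.
Proof.
move=> /[dup] s01 /andP[s0 s1]; have T0 : 0 < mlog s by rewrite mlog_gt0 ?s0.
have cT := is_derive1_continuous (is_derive_mlog s0).
have cU := is_derive1_continuous (is_derive_plog delta s01).
apply: continuousM.
  apply: continuousM; first by apply: continuousM => //; exact: cst_continuous.
  apply: continuousD; first exact: cst_continuous.
  by apply: continuousM => //; exact: cst_continuous.
apply: continuousV; first by rewrite expf_neq0// !mulf_neq0 ?gt_eqF.
have cg : {for s, continuous (fun s => 2 * s * mlog s)}.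
  by apply: continuousM => //; apply: continuousM; [exact: cst_continuous|exact: cvg_id].
apply: (@continuous_comp _ _ _ (fun s => 2 * s * mlog s) (fun y => y ^+ 2)) => //.
exact: exprn_continuous.
Qed.

Lemma expRN2_lt1 : expR (-2) < 1 :> R.
Proof. by rewrite expR_lt1; lra. Qed.

Lemma expRN1_lt1 : expR (-1) < 1 :> R.
Proof. by rewrite expR_lt1; lra. Qed.

(** The threshold [expR (-2)] is the square of the radius 1/e. Because [mlog] exceeds 1 below it,
    powers with exponent at most 1 are bounded by [mlog] itself, hence by [|x|^-1]. *)
Lemma mlog_gt1 s : 0 < s < expR (-2) -> 1 < mlog s.
Proof.
move=> /andP[s0 s1]; rewrite /mlog.
have : ln s < -2 by rewrite -(expRK (-2)) ltr_ln// posrE expR_gt0.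
lra.
Qed.

(* ln y <= y at y = s^(-1/2) *)
Lemma mlog_le s : 0 < s -> mlog s <= (Num.sqrt s)^-1.
Proof.
move=> s0; have r0 : 0 < Num.sqrt s by rewrite sqrtr_gt0.
have -> : mlog s = ln (Num.sqrt s)^-1.
  by rewrite lnV ?posrE// -{1}[s](sqr_sqrtr (ltW s0)) /mlog lnXn// mulr2n; field.
by apply: ltW; apply: ln_sublinear; rewrite invr_gt0.
Qed.

Lemma plog_ge0 delta s : 0 <= plog delta s.
Proof. exact: powR_ge0. Qed.

Lemma plog_le_mlog delta s : delta <= 1 -> 0 < s < expR (-2) -> plog delta s <= mlog s.
Proof. by move=> d1 /mlog_gt1 T1; rewrite /plog ler1_powR// ltW. Qed.

Lemma plog_le delta s : delta <= 1 -> 0 < s < expR (-2) -> plog delta s <= (Num.sqrt s)^-1.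
Proof.
move=> d1 /[dup] sI /andP[s0 _]; apply: le_trans (plog_le_mlog d1 sI) _; exact: mlog_le.
Qed.

(** The logarithm in the denominator of [plog1] absorbs [plog], so no logarithm survives in the
    bound. *)
Lemma plog1_le delta s : -1 < delta < 1 -> 0 < s < expR (-2) -> `|plog1 delta s| <= (2 * s)^-1.
Proof.
move=> /andP[d1 d2] /[dup] sI /andP[s0 _]; have T1 := mlog_gt1 sI.
have T0 : 0 < mlog s by rewrite (lt_trans ltr01).
have s2 : 0 < 2 * s by rewrite mulr_gt0.
have dn : `|delta| <= 1 by rewrite ler_norml; apply/andP; split; lra.
rewrite /plog1 !normrM normrN (ger0_norm (plog_ge0 _ _)) [`|(_ * _)^-1|]gtr0_norm; last first.
  by rewrite invr_gt0 mulr_gt0.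
rewrite (invfM (2 * s)) mulrCA mulrC -[leRHS]mul1r ler_wpM2r ?invr_ge0 ?(ltW s2)//.
by rewrite ler_pdivrMr// mul1r; apply: le_trans (plog_le_mlog (ltW d2) sI); rewrite ler_piMl ?plog_ge0.
Qed.

Lemma plog2_le delta s : -1 < delta < 1 -> 0 < s < expR (-2) -> `|plog2 delta s| <= 4 * (s ^+ 2)^-1.
Proof.
move=> /andP[d1 d2] /[dup] sI /andP[s0 _]; have T1 := mlog_gt1 sI.
have T0 : 0 < mlog s by rewrite (lt_trans ltr01).
have dn : `|delta| <= 1 by rewrite ler_norml; apply/andP; split; lra.
have s2 : 0 < s ^+ 2 by rewrite exprn_gt0.
rewrite /plog2 !normrM (ger0_norm (plog_ge0 _ _)) [`|(_ ^+ _)^-1|]gtr0_norm; last first.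
  by rewrite invr_gt0 exprn_gt0// !mulr_gt0.
rewrite exprMn invfM mulrA exprMn invfM.
have UT := plog_le_mlog (ltW d2) sI; have U0 := plog_ge0 delta s.
(* Here [|delta - 1| < 2 < 2 * mlog s]. *)
have h : `|delta - 1 + 2 * mlog s| <= 4 * mlog s by rewrite ler_norml; apply/andP; split; lra.
have H : `|delta| * plog delta s * `|delta - 1 + 2 * mlog s| <= 4 * mlog s ^+ 2.
  rewrite (_ : 4 * mlog s ^+ 2 = 1 * mlog s * (4 * mlog s)); last by ring.
  by rewrite ler_pM// ?mulr_ge0// ler_pM.
rewrite (_ : _ * _ = (`|delta| * plog delta s * `|delta - 1 + 2 * mlog s| / mlog s ^+ 2) * (4^-1 * (s ^+ 2)^-1)); last first.
  by field; rewrite !gt_eqF.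
apply: ler_pM.
- by rewrite divr_ge0 ?exprn_ge0 ?(ltW T0)// !mulr_ge0.
- by rewrite mulr_ge0// invr_ge0 ltW.
- by rewrite ler_pdivrMr ?exprn_gt0.
- by rewrite ler_piMl ?invr_ge0 ?(ltW s2)// invf_le1// ler1n.
Qed.

End log_power.

(** * The radial function, its gradient and its second derivatives *)

Section radial_solution.
Context {R : realType} {n : nat}.
Implicit Types (delta : R) (phi : 'rV[R]_n -> R) (x : 'rV[R]_n).
Local Notation mu := (@lebesgue_row R n).
Local Notation e_ i := (delta_mx ord0 i : 'rV[R]_n).
Local Notation B := (eball (expR (-1)) : set 'rV[R]_n).

(** Only a directional derivative of [w] is assumed, so the chain rule is reduced to the one on the
    real line by restricting [w] to the line [t *: v + x]. *)
Lemma is_derive_chain (x v : 'rV[R]_n) (w : 'rV[R]_n -> R) (h : R -> R) (dw dh : R) :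
  is_derive x v w dw -> is_derive (w x) (1 : R) h dh -> is_derive x v (h \o w) (dh * dw).
Proof.
move=> Dw Dh; pose c (t : R) : 'rV[R]_n := t *: v + x.
have cE (k : R) : c (k *: (1 : R) + 0) = k *: v + c 0.
  by rewrite /c addr0 scale0r add0r -[k *: 1]/(k * 1) mulr1.
have c0 : c 0 = x by rewrite /c scale0r add0r.
have := (@is_derive_line _ _ _ (h \o w) c 0 (1 : R) v (dh * dw) cE).2; rewrite c0; apply.
rewrite -compA; apply: is_derive1_comp; first by rewrite /= c0.
by apply: (@is_derive_line _ _ _ w c 0 (1 : R) v dw cE).1; rewrite c0.
Qed.

Lemma is_derive_coord x i j :
  is_derive x (e_ i) (fun y : 'rV[R]_n => y ord0 j) (j == i)%:R.
Proof.
have d := @derivable_id R 'rV[R]_n x (e_ i).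
apply: DeriveDef; first exact: ((derivable_mxP id x (e_ i)).1 d).
have := derive_mx d; rewrite derive_id => /matrixP/(_ ord0 j).
by rewrite !mxE eqxx => <-.
Qed.

Lemma is_derive_dot x i : is_derive x (e_ i) (fun y : 'rV[R]_n => dot y y) (2 * x ord0 i).
Proof.
have -> : (fun y => dot y y) = \sum_(j < n) (fun y : 'rV[R]_n => y ord0 j * y ord0 j).
  by apply/funext => y; rewrite fct_sumE.
have d j := is_deriveM (is_derive_coord x i j) (is_derive_coord x i j).
apply: (is_derive_eq (is_derive_sum d)).
rewrite (bigD1 i)//= big1 ?addr0 => [|j /negbTE ji]; rewrite /GRing.scale/=.
  by rewrite eqxx mulr1 mulr_natl mulr2n.
by rewrite ji !mulr0 addr0.
Qed.

Lemma u_logE delta x : u_log delta x = plog delta (dot x x).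
Proof.
rewrite /u_log /plog /mlog /enorm; congr (_ `^ _).
have := dot_ge0 x; rewrite le_eqVlt => /predU1P[<-|s0].
  by rewrite sqrtr0 ln0// mul0r.
by rewrite -[in RHS](sqr_sqrtr (ltW s0)) lnXn ?sqrtr_gt0// mulr2n; congr (- _); field.
Qed.

Lemma mlog_dot x : mlog (dot x x) = - ln (enorm x).
Proof.
rewrite /mlog /enorm.
have := dot_ge0 x; rewrite le_eqVlt => /predU1P[<-|s0].
  by rewrite sqrtr0 ln0// mul0r.
by rewrite -[in LHS](sqr_sqrtr (ltW s0)) lnXn ?sqrtr_gt0// mulr2n; congr (- _); field.
Qed.

Lemma eball_dot x : B x -> x != 0 -> 0 < dot x x < expR (-2).
Proof.
rewrite /eball/= => xB x0; rewrite -enorm_sqr exprn_gt0 ?enorm_gt0//=.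
have -> : expR (-2) = expR (-1) ^+ 2 :> R by rewrite -expRM_natl; congr expR; ring.
by rewrite ltr_pXn2r ?nnegrE ?enorm_ge0 ?expR_ge0.
Qed.

Lemma eball_dot1 x : B x -> x != 0 -> 0 < dot x x < 1.
Proof.
by move=> xB /(eball_dot xB)/andP[-> h]; rewrite (lt_trans h)// expRN2_lt1.
Qed.

Definition Glog delta x : 'rV[R]_n := (2 * plog1 delta (dot x x)) *: x.

(** The pure second derivative of [u_log delta] in the i-th coordinate, away from the origin. *)
Definition ddlog delta (i : 'I_n) x : R :=
  4 * x ord0 i ^+ 2 * plog2 delta (dot x x) + 2 * plog1 delta (dot x x).

Lemma is_derive_u_log delta x i : B x -> x != 0 ->
  is_derive x (e_ i) (u_log delta) (Glog delta x ord0 i).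
Proof.
move=> xB x0; have -> : u_log delta = plog delta \o (fun y : 'rV[R]_n => dot y y).
  by apply/funext => y; rewrite u_logE.
apply: (is_derive_eq (is_derive_chain (is_derive_dot x i) (is_derive_plog delta (eball_dot1 xB x0)))).
by rewrite /Glog !mxE; ring.
Qed.

Lemma is_derive_Glog delta x i : B x -> x != 0 ->
  is_derive x (e_ i) (fun y => Glog delta y ord0 i) (ddlog delta i x).
Proof.
move=> xB x0.
have -> : (fun y => Glog delta y ord0 i) =
    (cst 2 : 'rV[R]_n -> R) * (plog1 delta \o (fun y : 'rV[R]_n => dot y y)) * (fun y => y ord0 i).
  by apply/funext => y; rewrite /Glog !mxE.
have d1 := is_derive_chain (is_derive_dot x i) (is_derive_plog1 delta (eball_dot1 xB x0)).
apply: (is_derive_eq (is_deriveM (is_deriveM (is_derive_cst (2 : R) x (e_ i)) d1) (is_derive_coord x i i))).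
by rewrite /GRing.scale/= /ddlog /cst/= !fctE eqxx/=; ring.
Qed.

Lemma continuous_dot_comp (h : R -> R) x :
  {for dot x x, continuous h} -> {for x, continuous (fun y : 'rV[R]_n => h (dot y y))}.
Proof.
by move=> ch; apply: (@continuous_comp _ _ _ (fun y : 'rV[R]_n => dot y y) h) => //;
  exact: dot_continuous.
Qed.

Lemma continuous_u_log delta x : B x -> x != 0 -> {for x, continuous (@u_log R n delta)}.
Proof.
move=> xB x0; have -> : u_log delta = fun y : 'rV[R]_n => plog delta (dot y y).
  by apply/funext => y; rewrite u_logE.
apply: continuous_dot_comp; apply: is_derive1_continuous.
exact: is_derive_plog (eball_dot1 xB x0).
Qed.

Lemma continuous_Glog delta x i : B x -> x != 0 ->
  {for x, continuous (fun y => Glog delta y ord0 i)}.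
Proof.
move=> xB x0; have -> : (fun y => Glog delta y ord0 i) =
    (fun y : 'rV[R]_n => 2 * plog1 delta (dot y y) * y ord0 i).
  by apply/funext => y; rewrite /Glog !mxE.
apply: continuousM; last exact: coord_continuous.
apply: continuousM; first exact: cst_continuous.
apply: continuous_dot_comp; apply: is_derive1_continuous.
exact: is_derive_plog1 (eball_dot1 xB x0).
Qed.

Lemma continuous_ddlog delta x i : B x -> x != 0 -> {for x, continuous (ddlog delta i)}.
Proof.
move=> xB x0; apply: continuousD.
  apply: continuousM; last by apply: continuous_dot_comp; exact: continuous_plog2 (eball_dot1 xB x0).
  apply: continuousM; first exact: cst_continuous.
  apply: (@continuous_comp _ _ _ (fun y : 'rV[R]_n => y ord0 i) (fun y => y ^+ 2)).
    exact: coord_continuous.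
  exact: exprn_continuous.
apply: continuousM; first exact: cst_continuous.
apply: continuous_dot_comp; apply: is_derive1_continuous.
exact: is_derive_plog1 (eball_dot1 xB x0).
Qed.

Section bounds.
Variables (delta : R) (x : 'rV[R]_n).
Hypotheses (d1 : -1 < delta < 1) (xB : B x) (x0 : x != 0).

Let s01 := eball_dot xB x0.
Let s_gt0 : 0 < dot x x. Proof. by case/andP: s01. Qed.

Lemma enorm_lt1 : enorm x < 1.
Proof. by apply: lt_trans expRN1_lt1. Qed.

Let s_lt1 : dot x x < 1.
Proof. by case/andP: (eball_dot1 xB x0). Qed.

Lemma u_log_le : u_log delta x <= (enorm x)^-1.
Proof. by rewrite u_logE; apply: plog_le => //; case/andP: d1 => _ /ltW. Qed.

Lemma u_log_sqr_le : u_log delta x ^+ 2 <= 1 / enorm x ^+ 2.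
Proof.
rewrite div1r -exprVn ler_pXn2r ?nnegrE ?invr_ge0 ?enorm_ge0 ?powR_ge0//.
exact: u_log_le.
Qed.

Lemma inv_enorm_le : (enorm x)^-1 <= 1 / enorm x ^+ 2.
Proof.
rewrite div1r lef_pV2 ?posrE ?exprn_gt0 ?enorm_gt0//.
by rewrite expr2 ler_piMl ?enorm_ge0// ltW// enorm_lt1.
Qed.

Lemma Glog_coord_le i : `|Glog delta x ord0 i| <= (enorm x)^-1.
Proof.
rewrite /Glog mxE (normrM _ (x ord0 i)) (normrM 2) ger0_norm//.
apply: (@le_trans _ _ (2 * (2 * dot x x)^-1 * enorm x)).
  apply: ler_pM; rewrite ?mulr_ge0 ?coord_enorm//.
  by rewrite ler_pM2l//; exact: plog1_le.
by rewrite -enorm_sqr le_eqVlt; apply/orP; left; apply/eqP; field; rewrite enorm_eq0.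
Qed.

Lemma Glog_sqr_le i : Glog delta x ord0 i ^+ 2 <= 1 / enorm x ^+ 2.
Proof.
rewrite div1r -exprVn -real_normK ?num_real// ler_pXn2r ?nnegrE ?invr_ge0 ?enorm_ge0//.
exact: Glog_coord_le.
Qed.

(** The constant is 16 + 1: the term with [plog2] gives [4 s * 4 s^-2], the term with [plog1] gives
    [2 * (2 s)^-1]. *)
Lemma ddlog_le i : `|ddlog delta i x| <= 17 / enorm x ^+ 2.
Proof.
rewrite enorm_sqr (le_trans (ler_normD _ _))// (normrM (4 * _)) (normrM 4) (normrM 2).
rewrite !(@ger0_norm _ 2)// !(@ger0_norm _ 4)// normrX (_ : 17 / _ = 16 / dot x x + 1 / dot x x); last by field; rewrite gt_eqF.
rewrite lerD//.
  apply: (@le_trans _ _ (4 * dot x x * (4 * (dot x x ^+ 2)^-1))).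
    apply: ler_pM; rewrite ?mulr_ge0 ?exprn_ge0//; last exact: plog2_le.
    rewrite ler_pM2l// -enorm_sqr.
    by rewrite ler_pXn2r ?nnegrE ?enorm_ge0 ?coord_enorm.
  by rewrite le_eqVlt; apply/orP; left; apply/eqP; field; rewrite gt_eqF.
apply: (@le_trans _ _ (2 * (2 * dot x x)^-1)); first by rewrite ler_pM2l//; exact: plog1_le.
by rewrite le_eqVlt; apply/orP; left; apply/eqP; field; rewrite gt_eqF.
Qed.

End bounds.

End radial_solution.

(** * The two weak formulations *)

Section weak_solution_log.
Context {R : realType} {n : nat}.
Implicit Types (delta : R) (phi : 'rV[R]_n -> R) (x : 'rV[R]_n).
Local Notation mu := (@lebesgue_row R n).
Local Notation e_ i := (delta_mx ord0 i : 'rV[R]_n).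
Local Notation B := (eball (expR (-1)) : set 'rV[R]_n).
Hypothesis n3 : (3 <= n)%N.

Let B1 : expR (-1) <= 1 :> R. Proof. exact/ltW/expRN1_lt1. Qed.

Lemma measurable_u_log delta : measurable_fun B (@u_log R n delta).
Proof.
apply: measurable_fun_punctured; first exact: open_eball.
by move=> x xB x0; exact: continuous_u_log.
Qed.

Lemma measurable_Glog delta i : measurable_fun B (fun x : 'rV[R]_n => Glog delta x ord0 i).
Proof.
apply: measurable_fun_punctured; first exact: open_eball.
by move=> x xB x0; exact: continuous_Glog.
Qed.

Lemma in_L2_le (f : 'rV[R]_n -> R) (C : R) : measurable_fun B f ->
  (forall x, B x -> x != 0 -> f x ^+ 2 <= C / enorm x ^+ 2) -> in_L2 B f.
Proof.
move=> mf fC; split => //; apply: integrable_lty; first exact: measurable_eball.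
apply: (@integrable_le_inv_enorm_sqr _ _ _ C (fun x => f x ^+ 2)) => //.
  exact: measurable_funX.
by move=> x xB x0; rewrite ger0_norm ?sqr_ge0//; exact: fC.
Qed.

(** The constant 17 is generous here; integration by parts takes a single constant for a function
    and its derivative, and [ddlog] requires 17. *)
Lemma u_log_le_inv_sqr delta x : -1 < delta < 1 -> B x -> x != 0 ->
  `|u_log delta x| <= 17 / enorm x ^+ 2.
Proof.
move=> d1 xB x0; rewrite ger0_norm ?powR_ge0// (le_trans (u_log_le d1 xB x0))//.
rewrite (le_trans (inv_enorm_le xB x0))// ler_wpM2r ?invr_ge0 ?exprn_ge0 ?enorm_ge0//.
by rewrite ler1n.
Qed.

Lemma Glog_le_inv_sqr delta x i : -1 < delta < 1 -> B x -> x != 0 ->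
  `|Glog delta x ord0 i| <= 17 / enorm x ^+ 2.
Proof.
move=> d1 xB x0; rewrite (le_trans (Glog_coord_le d1 xB x0 i))//.
rewrite (le_trans (inv_enorm_le xB x0))// ler_wpM2r ?invr_ge0 ?exprn_ge0 ?enorm_ge0//.
by rewrite ler1n.
Qed.

Lemma W12_grad_u_log delta : -1 < delta < 1 -> W12_grad B (u_log delta) (Glog delta).
Proof.
move=> d1; split.
- apply: (@in_L2_le _ 1); first exact: measurable_u_log.
  by move=> x xB x0; exact: u_log_sqr_le.
- move=> i; apply: (@in_L2_le _ 1); first exact: measurable_Glog.
  by move=> x xB x0; exact: Glog_sqr_le.
move=> phi i tphi.
have [] := @integration_by_parts_punctured R n n3 _ i 17 (u_log delta)
  (fun x => Glog delta x ord0 i) phi B1 tphi => //.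
- by move=> x xB x0; exact: is_derive_u_log.
- by move=> x xB x0; exact: continuous_u_log.
- by move=> x xB x0; exact: continuous_Glog.
- by move=> x xB x0; exact: u_log_le_inv_sqr.
- by move=> x xB x0; exact: Glog_le_inv_sqr.
Qed.

Lemma ln_enorm x : ln (enorm x) = - mlog (dot x x).
Proof. by rewrite mlog_dot opprK. Qed.

Lemma dot_scale (a : R) x (y : 'rV[R]_n) : dot (a *: x) y = a * dot x y.
Proof. by rewrite /dot mulr_sumr; apply: eq_bigr => i _; rewrite mxE mulrA. Qed.

(** Since [u b = - grad u], the two fluxes cancel for every [phi], before any integration. *)
Lemma weak_integrand_b_log delta phi x :
  weak_integrand (b_log delta) (fun=> 0) (u_log delta) (Glog delta) phi x = 0.
Proof.
rewrite /weak_integrand /Glog /b_log -scaleNr !dot_scale !mul0r addr0 mulrA -mulrDl.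
rewrite (_ : _ + _ = 0) ?mul0r//.
rewrite u_logE enorm_sqr ln_enorm /plog1.
move: (dot x x) (plog delta (dot x x)) (mlog (dot x x)) => s c t.
(* With the inverses as independent unknowns the identity is polynomial, so the points where [s] or
   [t] is zero need no separate treatment. *)
rewrite !invfM !invrN; move: (s^-1) (t^-1) => a b.
by field.
Qed.

Lemma weak_solution_b_log delta : -1 < delta < 1 ->
  weak_solution B (b_log delta) (fun=> 0) (@u_log R n delta).
Proof.
move=> d1; exists (Glog delta); first exact: W12_grad_u_log.
move=> phi tphi; have E : weak_integrand (b_log delta) (fun=> 0) (u_log delta) (Glog delta) phi = cst 0.
  by apply/funext => x; rewrite weak_integrand_b_log.
rewrite E; split; last by rewrite /Rintegral integral0.
by apply: (eq_integrable _ (cst 0%E)) => //; [exact: measurable_eball|exact: integrable0].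
Qed.

(** The right side is [4 s plog2 + 2 n plog1], the Laplacian of a function of [s = |x|^2]. At the
    origin both sides vanish because [ln 0] and [0^-1] are 0. *)
Lemma sum_ddlog delta x : B x -> d_log delta x * u_log delta x = \sum_i ddlog delta i x.
Proof.
move=> xB; rewrite /ddlog big_split/= sumr_const card_ord -mulr_suml -mulr_sumr -dot_sqr.
have [->|x0] := eqVneq x 0.
  rewrite /d_log /plog1 /dot !enorm0 expr0n/= !mul0r !invr0 !mulr0 addr0 mul0r.
  rewrite (eq_bigr (fun=> 0)) ?big1 ?mulr0 ?mul0r// ?mul0rn ?invr0 ?mulr0 ?mul0rn ?addr0//.
  by move=> i _; rewrite mxE mul0r.
have s01 := eball_dot1 xB x0; have s0 : dot x x != 0 by case/andP: s01 => /gt_eqF ->.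
have t0 : mlog (dot x x) != 0 by rewrite gt_eqF// mlog_gt0.
rewrite /d_log u_logE ln_enorm enorm_sqr /plog1 /plog2.
rewrite -[in RHS]mulr_natr sqrrN.
by field; rewrite s0 t0.
Qed.

(** The integrand is the divergence of [phi] times the gradient; each of its [n] terms is integrable
    and integrates to zero separately. *)
Lemma weak_solution_d_log delta : -1 < delta < 1 ->
  weak_solution B (fun=> 0) (d_log delta) (@u_log R n delta).
Proof.
move=> d1; exists (Glog delta); first exact: W12_grad_u_log.
move=> phi tphi; have mB := @measurable_eball R n (expR (-1)).
pose h i x := Glog delta x ord0 i * partial i phi x + ddlog delta i x * phi x.
have hE : {in B, weak_integrand (fun=> 0) (d_log delta) (u_log delta) (Glog delta) phi
    =1 \sum_i h i}.
  move=> x /set_mem xB; rewrite fct_sumE /weak_integrand sum_ddlog// mulr_suml.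
  rewrite [X in _ + _ * X + _](_ : _ = 0) ?mulr0 ?addr0; last first.
    by rewrite /dot big1// => i _; rewrite mxE mul0r.
  rewrite /dot -big_split/=; apply: eq_bigr => i _.
  by rewrite /h /grad [X in _ * X + _ = _]mxE.
have [ih Ih] : mu.-integrable B (EFin \o \sum_i h i) /\ \int[mu]_(x in B) (\sum_i h i) x = 0.
  elim/big_ind : _ => [|f g [if_ If] [ig Ig]|i _].
  - split; last by rewrite /Rintegral integral0.
    by apply: (eq_integrable _ (cst 0%E)) => //; exact: integrable0.
  - split; first exact: (integrableD mB if_ ig).
    by rewrite /= RintegralD// If Ig addr0.
  have [] := @integration_by_parts_punctured R n n3 _ i 17
    (fun x => Glog delta x ord0 i) (ddlog delta i) phi B1 tphi.
  - by move=> x xB x0; exact: is_derive_Glog.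
  - by move=> x xB x0; exact: continuous_Glog.
  - by move=> x xB x0; exact: continuous_ddlog.
  - by move=> x xB x0; exact: Glog_le_inv_sqr.
  - by move=> x xB x0; exact: ddlog_le.
  move=> i1 i2 I.
  split; first exact: (integrableD mB i1 i2).
  by rewrite RintegralD// I addNr.
split.
  apply: (eq_integrable _ (EFin \o \sum_i h i)) => // x xB /=.
  by rewrite hE// inE.
by rewrite -Ih; apply: eq_Rintegral.
Qed.

End weak_solution_log.

(** The integral of a nonnegative function is a supremum over the simple functions below it, hence
    monotone without measurability. Thus measurability of [rearrangement] in [tau] never has to be
    discussed. *)
Lemma ge0_le_integral_any (d : measure_display) (T : measurableType d) (R : realType)
    (mu : {measure set T -> \bar R}) (D : set T) (f g : T -> \bar R) :
  (forall x, D x -> 0 <= f x)%E -> (forall x, D x -> f x <= g x)%E ->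
  (\int[mu]_(x in D) f x <= \int[mu]_(x in D) g x)%E.
Proof.
move=> f0 fg; rewrite !(integral_mkcond D).
have h0 x : (0 <= (f \_ D) x)%E by apply: erestrict_ge0.
have h1 x : (0 <= (g \_ D) x)%E.
  by apply: erestrict_ge0 => y Dy; exact: le_trans (f0 _ Dy) (fg _ Dy).
rewrite !ge0_integralTE//; apply: ge_ereal_sup => _ [h hf <-].
apply: ereal_sup_ubound; exists h => // x; apply: le_trans (hf x) _.
by rewrite !patchE; case: ifPn => // /set_mem /fg.
Qed.

(** * Integrals of negative powers of the logarithm *)

Section log_integral.
Context {R : realType}.
Variable n : nat.
Hypothesis n_gt0 : (0 < n)%N.
Implicit Types (tau s : R).

(* The ball of radius expR (- radlog tau) is contained in a cube of measure tau. *)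
Definition radlog tau : R := ln 2 - ln tau / n%:R.

(** This is [(2 / e)^n], the volume of the cube circumscribed about the ball, and the point where
    [radlog] equals 1. *)
Definition tau0 : R := expR (n%:R * (ln 2 - 1)).

Let n0 : (n%:R : R) != 0. Proof. by rewrite pnatr_eq0 -lt0n. Qed.
Let n_pos : 0 < (n%:R : R). Proof. by rewrite ltr0n. Qed.

Lemma tau0_gt0 : 0 < tau0. Proof. exact: expR_gt0. Qed.

Lemma radlog_ge1 tau : 0 < tau -> (1 <= radlog tau) = (tau <= tau0).
Proof.
move=> t0; rewrite /radlog /tau0 -ler_ln ?posrE ?expR_gt0// expRK.
by rewrite [n%:R * _]mulrC -ler_pdivrMr//; move: (ln tau / n%:R) => z; apply/idP/idP; lra.
Qed.

Lemma is_derive_radlog tau : 0 < tau ->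
  is_derive tau (1 : R) radlog (- (n%:R * tau)^-1).
Proof.
move=> t0; have dl := is_derive1_ln t0.
apply: (is_derive_eq (is_deriveB (is_derive_cst (ln 2 : R) tau (1 : R))
  (is_deriveM dl (is_derive_cst (n%:R^-1 : R) tau (1 : R))))).
by rewrite /GRing.scale/= /cst mulr0 !add0r invfM.
Qed.

(** [F] is a nonnegative antiderivative and equals [n / (s - 1)] at [tau0], where [radlog] is 1. The
    bound on each [[a k, tau0]] is therefore independent of [k] and passes to the limit. *)
Lemma integral_radlog_power s : 1 < s ->
  (\int[lebesgue_measure]_(tau in `]0%R, tau0]) (radlog tau `^ (- s) * tau^-1)%:E
   <= (n%:R / (s - 1))%:E)%E.
Proof.
move=> s1; have s10 : 0 < s - 1 by rewrite subr_gt0.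
pose f tau := radlog tau `^ (- s) * tau^-1.
pose F tau := n%:R / (s - 1) * radlog tau `^ (1 - s).
(* The shift by 2 keeps [a k] strictly below [tau0] already for [k = 0]. *)
pose a (k : nat) : R := tau0 / k.+2%:R.
have a0 k : 0 < a k by rewrite divr_gt0 ?tau0_gt0.
have at0 k : a k < tau0 by rewrite ltr_pdivrMr// ltr_pMr ?tau0_gt0// ltr1n.
have f0 tau : 0 < tau -> 0 <= f tau by move=> t0; rewrite mulr_ge0 ?powR_ge0// invr_ge0 ltW.
have L0 tau : 0 < tau <= tau0 -> 0 < radlog tau.
  by move=> /andP[t0 t1]; apply: (@lt_le_trans _ _ 1) => //; rewrite radlog_ge1.
have dF tau : 0 < tau -> 0 < radlog tau -> is_derive tau (1 : R) F (f tau).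
  move=> t0 l0; have dL := is_derive_radlog t0.
  have dP := is_derive1_comp (is_derive1_powR (1 - s) l0) dL.
  apply: (is_derive_eq (is_deriveM (is_derive_cst (n%:R / (s - 1) : R) tau (1 : R)) dP)).
  rewrite /GRing.scale/= /cst mulr0 addr0 /f.
  rewrite (_ : 1 - s - 1 = - s); last by ring.
  by field; rewrite n0 !gt_eqF.
have cf tau : 0 < tau -> 0 < radlog tau -> {for tau, continuous f}.
  move=> t0 l0; apply: continuousM; last by apply: inv_continuous; rewrite gt_eqF.
  have dP := is_derive1_comp (is_derive1_powR (- s) l0) (is_derive_radlog t0).
  exact: is_derive1_continuous dP.
pose I k := `[a k, tau0]%classic.
have II k tau : I k tau -> 0 < tau <= tau0.
  by rewrite /I/= in_itv/= => /andP[h ->]; rewrite andbT (lt_le_trans _ h).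
have UI : `]0%R, tau0]%classic = \bigcup_k I k.
  apply/seteqP; split => tau; last by move=> [k _ /II]; rewrite /= in_itv.
  rewrite /= in_itv/= => /andP[t0 t1].
  exists (Num.truncn (tau0 / tau)) => //; rewrite /I/= in_itv/= t1 andbT /a.
  rewrite ler_pdivrMr// -ler_pdivrMl// mulrC.
  have := @truncnS_gt _ (tau0 / tau); move=> /ltW /le_trans; apply.
  by rewrite ler_nat.
have mI k : measurable (I k) by exact: measurable_itv.
have mf k : measurable_fun (I k) (EFin \o f).
  apply/measurable_EFinP; apply: measurable_funM.
    apply: (measurable_funS measurableT) => //.
    apply: (@measurableT_comp _ _ _ _ _ _ (fun x => x `^ (- s)) _ radlog).
      exact: measurable_powR.
    apply: measurable_funB => //; apply: measurable_funM => //; exact: measurable_ln.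
  by apply: (measurable_funS measurableT) => //; exact: measurable_invr.
have ndI : nondecreasing_seq I.
  move=> k l kl; apply/subsetPset => tau; rewrite /I/= !in_itv/= => /andP[h ->].
  rewrite andbT (le_trans _ h)// /a ler_pM2l ?tau0_gt0// lef_pV2 ?posrE//.
  by rewrite ler_nat !ltnS.
rewrite UI.
have cv : (\int[lebesgue_measure]_(x in I i) (f x)%:E @[i --> \oo] -->
    \int[lebesgue_measure]_(x in \bigcup_i I i) (f x)%:E)%E.
  apply: ge0_nondecreasing_set_cvg_integral => // k x /II/andP[x0 _].
  by rewrite lee_fin f0.
rewrite -(cvg_lim _ cv)//; apply: lime_le; first by apply/cvg_ex; eexists; exact: cv.
apply: nearW => k /=; rewrite (@continuous_FTC2 _ f F).
- rewrite -EFinB lee_fin.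
  apply: (@le_trans _ _ (F tau0)).
    by rewrite gerBl// mulr_ge0 ?powR_ge0// divr_ge0// ltW.
  rewrite /F (_ : radlog tau0 = 1) ?powR1 ?mulr1//.
  by rewrite /radlog /tau0 expRK; field.
- exact: at0.
- apply: continuous_in_subspaceT => tau /set_mem /II tI.
  by apply: cf; [case/andP: tI|exact: L0].
- have cF tau : 0 < tau <= tau0 -> {for tau, continuous F}.
    move=> tI; apply: is_derive1_continuous; apply: dF; last exact: L0.
    by case/andP: tI.
  split.
  + move=> tau; rewrite in_itv/= => /andP[h1 h2].
    have tI : 0 < tau <= tau0 by rewrite (lt_trans (a0 k) h1) ltW.
    by have [] := dF tau (proj1 (andP tI)) (L0 _ tI).
  + by apply: cvg_at_right_filter; apply: cF; rewrite a0 ltW.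
  + by apply: cvg_at_left_filter; apply: cF; rewrite tau0_gt0 lexx.
- move=> tau; rewrite in_itv/= => /andP[h1 h2].
  have tI : 0 < tau <= tau0 by rewrite (lt_trans (a0 k) h1) ltW.
  by rewrite derive1E; have [] := dF tau (proj1 (andP tI)) (L0 _ tI).
Qed.

End log_integral.

(** * Lorentz quasinorms of functions with a logarithmic bound *)

Section lorentz_log.
Context {R : realType} {n : nat}.
Variable m : nat.
Hypotheses (n_gt0 : (0 < n)%N) (m_gt0 : (0 < m)%N).
Implicit Types (A s tau : R) (h : 'rV[R]_n -> R).
Local Notation mu := (@lebesgue_row R n).
Local Notation B := (eball (expR (-1)) : set 'rV[R]_n).
Local Notation radlog := (@radlog R n).
Local Notation tau0 := (@tau0 R n).

Let n0 : (n%:R : R) != 0. Proof. by rewrite pnatr_eq0 -lt0n. Qed.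

(** Both coefficients are of this type: [m = 1] for the length of [b_log], [m = 2] for [d_log]. *)
Definition log_bounded A h := measurable_fun B h /\
  forall x, B x -> x != 0 -> `|h x| <= A / (enorm x ^+ m * - ln (enorm x)).

(** With [h = ln r - ln rho >= 0], the inequality [expR h >= 1 + h] and [- ln r > 1] give
    [expR h * - ln r >= - ln r + h = - ln rho]; multiply by [rho]. *)
Lemma mul_ln_mono (rho r : R) : 0 < rho -> rho <= r -> r < expR (-1) ->
  rho * - ln rho <= r * - ln r.
Proof.
move=> rho0 rhor re; have r0 := lt_le_trans rho0 rhor.
have b1 : 1 < - ln r by rewrite ltrNr -(expRK (-1)) ltr_ln// posrE expR_gt0.
have ab : - ln r <= - ln rho by rewrite lerN2 ler_ln.
have E : r = rho * expR (ln r - ln rho).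
  by rewrite expRD expRN !lnK ?posrE// mulrCA divff ?mulr1// gt_eqF.
rewrite (_ : r * _ = rho * (expR (ln r - ln rho) * - ln r)); last by rewrite {1}E mulrA.
rewrite ler_pM2l//.
move: (@expR_ge1Dx R (ln r - ln rho)); move: (ln r) (ln rho) b1 ab => b a b1 ab.
by move: (expR _) => e he; nra.
Qed.

Lemma pow_ln_mono (rho r : R) : 0 < rho -> rho <= r -> r < expR (-1) ->
  rho ^+ m * - ln rho <= r ^+ m * - ln r.
Proof.
move=> rho0 rhor re; have r0 := lt_le_trans rho0 rhor.
case: m m_gt0 => // k _; rewrite !exprSr -!mulrA.
have ln0 : 0 <= rho * - ln rho.
  rewrite mulr_ge0 ?(ltW rho0)// oppr_ge0 ln_le0//.
  by rewrite (le_trans rhor)// (le_trans (ltW re))// ltW// expRN1_lt1.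
apply: ler_pM; rewrite ?exprn_ge0 ?(ltW rho0)//; last exact: mul_ln_mono.
by apply: lerXn2r; rewrite // nnegrE ltW.
Qed.

Lemma cube_radlog tau : 0 < tau -> (2 * expR (- radlog tau)) ^+ n = tau.
Proof.
move=> t0; have {1}-> : (2 : R) = expR (ln 2) by rewrite lnK// posrE.
rewrite -expRD -expRM_natl /radlog (_ : _ * _ = ln tau) ?lnK//.
by field.
Qed.

(** The level is the value of the bound on the sphere of radius [expR (- radlog tau)]. The bound
    decreases in [|x|], so the superlevel set lies in that ball, hence in a cube of volume [tau].
    For [tau > tau0] the whole ball has measure at most [tau], and every positive level is
    admissible. *)
Lemma rearrangement_log_le A h tau : 0 < A -> log_bounded A h -> 0 < tau ->
  (rearrangement B h tau <=
   (if tau <= tau0 then A * expR (m%:R * radlog tau) / radlog tau else 0)%:E)%E.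
Proof.
move=> A0 [mh hA] t0.
have mB : measurable B by exact: measurable_eball.
have mS t : measurable (B `&` [set x | t < `|h x|]).
  rewrite (_ : mkset _ = (fun x => `|h x|) @^-1` `]t, +oo[%classic).
    by apply: (measurableT_comp (@normr_measurable _ _) mh).
  by apply/seteqP; split => x /=; rewrite in_itv/= andbT.
case: ifPn => [tt0|].
  have L1 : 1 <= radlog tau by rewrite radlog_ge1.
  have L0 : 0 < radlog tau by rewrite (lt_le_trans ltr01).
  apply: ereal_inf_lbound; exists (A * expR (m%:R * radlog tau) / radlog tau) => //.
  split; first by rewrite divr_gt0// mulr_gt0// expR_gt0.
  rewrite -[X in (_ <= X%:E)%E](cube_radlog t0) -lebesgue_row_cube ?expR_ge0//.
  apply: le_measure; rewrite ?inE//; first exact: measurable_cube.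
  move=> x [xB]/=; rewrite ltNge => /negP hx; apply: eball_sub_cube.
  rewrite /eball/= ltNge; apply/negP => rx; apply: hx.
  have x0 : x != 0 by rewrite -enorm_gt0 (lt_le_trans _ rx)// expR_gt0.
  rewrite (le_trans (hA _ xB x0))// -mulrA ler_pM2l//.
  rewrite -[expR (_ * radlog tau)]invrK -expRN -mulrN expRM_natl -invfM.
  have := pow_ln_mono (expR_gt0 _) rx xB; rewrite expRK opprK.
  rewrite lef_pV2 ?posrE//.
    rewrite mulr_gt0 ?exprn_gt0 ?enorm_gt0// oppr_gt0 ln_lt0// enorm_gt0 x0.
    exact: enorm_lt1.
  by rewrite mulr_gt0// exprn_gt0// expR_gt0.
rewrite -ltNge => tt0; apply/lee_addgt0Pr => e e0; rewrite add0e.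
apply: ereal_inf_lbound; exists e => //; split => //.
apply: (@le_trans _ _ (mu B)).
  by apply: le_measure; rewrite ?inE// => x [].
apply: (le_trans (eball_le (expR_ge0 _))); rewrite lee_fin (le_trans _ (ltW tt0))//.
have {1}-> : (2 : R) = expR (ln 2) by rewrite lnK// posrE.
by rewrite -expRD -expRM_natl.
Qed.

(** The powers cancel, [tau^(m/n) * expR (m * radlog tau) = 2^m], and only the logarithm is left. *)
Lemma powR_rearrangement_log_le p A h tau : p^-1 = m%:R / n%:R -> 0 < A ->
  log_bounded A h -> 0 < tau ->
  ((tau `^ p^-1)%:E * rearrangement B h tau <=
   (if tau <= tau0 then A * 2 ^+ m / radlog tau else 0)%:E)%E.
Proof.
move=> pE A0 hA t0.
apply: (le_trans (lee_wpmul2l _ (rearrangement_log_le A0 hA t0))).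
  by rewrite lee_fin powR_ge0.
rewrite -EFinM lee_fin; case: ifPn => _; last by rewrite mulr0.
rewrite le_eqVlt; apply/orP; left; apply/eqP.
have -> : (2 : R) = expR (ln 2) by rewrite lnK// posrE.
rewrite /powR gt_eqF// mulrA [_ * (A * _)]mulrCA -expRD -expRM_natl pE; congr (_ * expR _ / _).
by rewrite /radlog; field.
Qed.

Lemma rearrangement_ge0 h tau : (0 <= rearrangement B h tau)%E.
Proof. by apply: le_ereal_inf_tmp => _ [t [t0 _] <-]; rewrite lee_fin ltW. Qed.

(** The constant is fixed before [A] and [h]: linearity in [A] is what later makes the quasinorms as
    small as desired. *)
Lemma lorentz_norm_log_le p (q : \bar R) : p^-1 = m%:R / n%:R -> (1 < q)%E ->
  exists2 C : R, 0 < C & forall A h, 0 < A -> log_bounded A h ->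
    (lorentz_norm p q B h <= (A * C)%:E)%E.
Proof.
move=> pE; case: q => [s|_|//]; last first.
  exists (2 ^+ m); first exact: exprn_gt0.
  move=> A h A0 hA; apply: ge_ereal_sup => _ [tau + <-].
  rewrite /= in_itv/= andbT => t0.
  apply: (le_trans (powR_rearrangement_log_le pE A0 hA t0)); rewrite lee_fin.
  case: ifPn => [|_]; last by rewrite mulr_ge0 ?ltW// exprn_gt0.
  rewrite -radlog_ge1// => L1; rewrite ler_pdivrMr ?(lt_le_trans _ L1)//.
  by rewrite ler_peMr// mulr_ge0 ?exprn_ge0// ltW.
rewrite lte_fin => s1; have s0 : 0 < s by rewrite (lt_trans ltr01).
have s10 : 0 < s - 1 by rewrite subr_gt0.
exists (2 ^+ m * (n%:R / (s - 1)) `^ s^-1).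
  by rewrite mulr_gt0 ?exprn_gt0// powR_gt0// divr_gt0// ltr0n.
move=> A h A0 hA; rewrite /lorentz_norm; set K := A * 2 ^+ m.
have K0 : 0 < K by rewrite mulr_gt0// exprn_gt0.
have -> : A * (2 ^+ m * (n%:R / (s - 1)) `^ s^-1) = (K `^ s * (n%:R / (s - 1))) `^ s^-1.
  rewrite powRM ?powR_ge0 ?divr_ge0 ?(ltW s10)// -powRrM divff ?gt_eqF// powRr1 ?ltW//.
  by rewrite mulrA.
rewrite -poweR_EFin; apply: gt0_ler_poweR.
- by rewrite invr_ge0 ltW.
- rewrite in_itv/= leey andbT; apply: integral_ge0 => tau; rewrite /= in_itv/= andbT => t0.
  by rewrite mule_ge0 ?poweR_ge0// lee_fin invr_ge0 ltW.
- by rewrite in_itv/= leey andbT lee_fin mulr_ge0 ?powR_ge0// divr_ge0 ?(ltW s10).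
have le1 := @ge0_le_integral_any _ _ R lebesgue_measure `]0%R, +oo[%classic
  (fun tau => ((tau `^ p^-1)%:E * rearrangement B h tau) `^ s * (tau^-1)%:E)%E
  ((EFin \o (fun tau => K `^ s * (radlog tau `^ (- s) * tau^-1)))
       \_ (`]0%R, tau0]%classic)).
apply: (le_trans (le1 _ _)) => {le1} [tau|tau|]; rewrite /= ?in_itv/= ?andbT.
- move=> t0; by rewrite mule_ge0 ?poweR_ge0// lee_fin invr_ge0 ltW.
- move=> t0.
  have gle := powR_rearrangement_log_le pE A0 hA t0.
  have g0 : (0 <= (tau `^ p^-1)%:E * rearrangement B h tau)%E.
    by rewrite mule_ge0 ?rearrangement_ge0// lee_fin powR_ge0.
  rewrite patchE mem_setE in_itv/= t0/=; case: ifPn gle => [tt0|tt0] gle.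
    have L0 : 0 < radlog tau by rewrite (lt_le_trans ltr01)// radlog_ge1.
    rewrite mulrA EFinM lee_pmul2r ?lte_fin ?invr_gt0//.
    apply: (@le_trans _ _ ((K / radlog tau)%:E `^ s)%E).
      apply: gt0_ler_poweR => //; first exact: ltW.
      + by rewrite in_itv/= g0 leey.
      + by rewrite in_itv/= leey andbT lee_fin divr_ge0 ?ltW.
    rewrite poweR_EFin lee_fin powRM ?invr_ge0 ?(ltW K0) ?(ltW L0)//.
    by rewrite powRN -powR_inv1 ?(ltW L0)// powRAC powR_inv1// powR_ge0.
  have -> : ((tau `^ p^-1)%:E * rearrangement B h tau = 0)%E by apply/eqP; rewrite eq_le gle.
  by rewrite poweR0r ?gt_eqF// mul0e.
rewrite -integral_mkcondr (_ : _ `&` _ = `]0%R, tau0]%classic); last first.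
  apply/seteqP; split => tau /=; first by case.
  by rewrite !in_itv/= => /andP[-> ->].
under eq_integral do rewrite /= EFinM.
rewrite ge0_integralZl//.
- by rewrite EFinM lee_pmul2l ?lte_fin ?powR_gt0//; exact: integral_radlog_power.
- apply/measurable_EFinP; apply: measurable_funM.
    apply: (measurable_funS measurableT) => //.
    apply: (@measurableT_comp _ _ _ _ _ _ (fun x => x `^ (- s)) _ radlog).
      exact: measurable_powR.
    apply: measurable_funB => //; apply: measurable_funM => //; exact: measurable_ln.
  by apply: (measurable_funS measurableT) => //; exact: measurable_invr.
- move=> tau; rewrite /= in_itv/= => /andP[t0 _].
  by rewrite lee_fin mulr_ge0 ?powR_ge0// invr_ge0 ltW.
- by rewrite lee_fin powR_ge0.
Qed.

End lorentz_log.

(** * Lorentz bounds for the two coefficients *)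

Section lorentz_coefficients.
Context {R : realType} {n : nat}.
Hypothesis n3 : (3 <= n)%N.
Implicit Types (delta A : R) (x : 'rV[R]_n).
Local Notation B := (eball (expR (-1)) : set 'rV[R]_n).

Let n_gt0 : (0 < n)%N. Proof. exact: leq_trans n3. Qed.

Lemma measurable_ln_enorm : measurable_fun setT (fun x : 'rV[R]_n => ln (enorm x)).
Proof. by apply: measurableT_comp; [exact: measurable_ln|exact: measurable_enorm]. Qed.

Lemma measurable_inv (f : 'rV[R]_n -> R) :
  measurable_fun setT f -> measurable_fun setT (fun x => (f x)^-1).
Proof. by move=> mf; apply: measurableT_comp => //; exact: measurable_invr. Qed.

Lemma measurable_b_log delta : measurable_fun setT (@b_log R n delta).
Proof.
apply/measurable_fun_rowP => i.
rewrite (_ : (fun _ => _) =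
    (fun x : 'rV[R]_n => - (delta * (enorm x ^+ 2 * ln (enorm x))^-1 * x ord0 i))); last first.
  by apply/funext => x; rewrite /b_log !mxE.
apply: measurable_funN; apply: measurable_funM; last exact: measurable_coord.
apply: measurable_funM => //; apply: measurable_inv; apply: measurable_funM.
  by apply: measurable_funX; exact: measurable_enorm.
exact: measurable_ln_enorm.
Qed.

Lemma measurable_d_log delta : measurable_fun setT (@d_log R n delta).
Proof.
have me := @measurable_enorm R n; have ml := measurable_ln_enorm.
by apply: measurable_funD; apply: measurable_funM => //; apply: measurable_inv;
  apply: measurable_funM => //; apply: measurable_funX.
Qed.

Lemma enorm_scale (a : R) x : enorm (a *: x) = `|a| * enorm x.
Proof.
rewrite /enorm dot_scale /dot.
under eq_bigr do rewrite mxE mulrCA; rewrite -mulr_sumr mulrA -expr2 sqrtrM ?sqr_ge0//.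
by rewrite sqrtr_sqr.
Qed.

Lemma enormN x : enorm (- x) = enorm x.
Proof. by rewrite -scaleN1r enorm_scale normrN1 mul1r. Qed.

Lemma enorm_ln x : B x -> x != 0 -> 0 < enorm x /\ 1 < - ln (enorm x).
Proof.
move=> xB x0; have e0 : 0 < enorm x by rewrite enorm_gt0.
by split => //; rewrite ltrNr -(expRK (-1)) ltr_ln// posrE expR_gt0.
Qed.

Lemma b_log_bounded delta A : `|delta| <= A -> log_bounded 1 A (enorm \o @b_log R n delta).
Proof.
move=> dA; split.
  apply: measurable_funTS; apply: measurableT_comp; first exact: measurable_enorm.
  exact: measurable_b_log.
move=> x xB x0; have [e0 l1] := enorm_ln xB x0; have l0 := lt_trans ltr01 l1.
rewrite /= ger0_norm ?enorm_ge0// /b_log enormN enorm_scale expr1.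
rewrite !normrM normfV normrM -[`|ln _|]normrN (gtr0_norm l0) (gtr0_norm (exprn_gt0 2 e0)).
rewrite (_ : _ * _ = `|delta| / (enorm x * - ln (enorm x))); last first.
  have ln0 : ln (enorm x) != 0 by rewrite -oppr_eq0 gt_eqF.
  by field; rewrite ln0 gt_eqF.
by rewrite ler_pM2r// invr_gt0 mulr_gt0.
Qed.

(** The factor [delta] common to both terms keeps the bound linear in [A]; since [- ln |x| > 1], the
    remaining factor is at most [2 + (n - 2)]. *)
Lemma d_log_bounded delta A : -1 < delta < 1 -> `|delta| <= A ->
  log_bounded 2 (A * (n%:R + 2)) (@d_log R n delta).
Proof.
move=> /andP[d1 d2] dA; split; first by apply: measurable_funTS; exact: measurable_d_log.
move=> x xB x0; have [e0 l1] := enorm_ln xB x0; have l0 := lt_trans ltr01 l1.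
have A0 : 0 <= A by exact: le_trans dA.
have n2 : 0 <= n%:R - 2 :> R by rewrite subr_ge0 ler_nat (leq_trans _ n3).
rewrite /d_log; set e := enorm x ^+ 2; set l := - ln (enorm x) in l0 l1 *.
have e20 : 0 < e by rewrite exprn_gt0.
have -> : ln (enorm x) = - l by rewrite opprK.
clearbody l e.
rewrite (_ : _ + _ = delta * ((delta - 1) / l - (n%:R - 2)) / (e * l)); last first.
  by field; rewrite (gt_eqF e20) (gt_eqF l0).
rewrite normrM normfV (gtr0_norm (mulr_gt0 e20 l0)) ler_pM2r ?invr_gt0 ?mulr_gt0//.
rewrite normrM ler_pM// (le_trans (ler_normB _ _))// (ger0_norm n2).
rewrite normrM normfV (gtr0_norm l0).
have h1 : `|delta - 1| / l <= 2.
  rewrite ler_pdivrMr// (@le_trans _ _ 2)//; last by rewrite ler_peMr// ltW.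
  by rewrite ler_norml; apply/andP; split; lra.
by lra.
Qed.

(** [A] is kept apart from [delta] because the estimate wants [A > 0], while [delta] may be zero or
    negative. *)
Lemma lorentz_b_log_small (q : \bar R) : (1 < q)%E -> exists2 C : R, 0 < C &
  forall delta A, 0 < A -> `|delta| <= A ->
    in_lorentz_vec n%:R q B (b_log delta) /\
    (lorentz_norm n%:R q B (enorm \o @b_log R n delta) <= (A * C)%:E)%E.
Proof.
move=> q1; have pE : n%:R^-1 = 1%:R / n%:R :> R by rewrite div1r.
have [C C0 CP] := @lorentz_norm_log_le R n 1 n_gt0 isT _ q pE q1.
exists C => // delta A A0 dA; have le := CP _ _ A0 (b_log_bounded dA).
split => //; split; last exact: le_lt_trans le (ltry _).
by apply: measurable_funTS; exact: measurable_b_log.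
Qed.

Lemma lorentz_d_log_small (q : \bar R) : (1 < q)%E -> exists2 C : R, 0 < C &
  forall delta A, -1 < delta < 1 -> 0 < A -> `|delta| <= A ->
    in_lorentz (n%:R / 2) q B (@d_log R n delta) /\
    (lorentz_norm (n%:R / 2) q B (@d_log R n delta) <= (A * C)%:E)%E.
Proof.
move=> q1; have pE : (n%:R / 2)^-1 = 2%:R / n%:R :> R by rewrite invfM invrK mulrC.
have [C C0 CP] := @lorentz_norm_log_le R n 2 n_gt0 isT _ q pE q1.
have n2 : 0 < n%:R + 2 :> R by rewrite addr_gt0// ltr0n.
exists ((n%:R + 2) * C); first exact: mulr_gt0.
move=> delta A d1 A0 dA; have le := CP _ _ (mulr_gt0 A0 n2) (d_log_bounded d1 dA).
rewrite mulrA; split => //; split; last exact: le_lt_trans le (ltry _).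
by apply: measurable_funTS; exact: measurable_d_log.
Qed.

End lorentz_coefficients.

(** * Behaviour of the solution near the origin and on the boundary sphere *)

Section log_behaviour.
Context {R : realType} {n : nat}.
Hypothesis n3 : (3 <= n)%N.
Implicit Types (delta r : R) (x : 'rV[R]_n).
Local Notation mu := (@lebesgue_row R n).
Local Notation B := (eball (expR (-1)) : set 'rV[R]_n).

Lemma u_log_boundary delta x : enorm x = expR (-1) -> u_log delta x = 1.
Proof. by rewrite /u_log => ->; rewrite expRK opprK powR1. Qed.

Lemma u_log_gt0 delta x : B x -> x != 0 -> 0 < u_log delta x.
Proof.
by move=> xB x0; have [_ l1] := enorm_ln xB x0; rewrite powR_gt0// (lt_trans _ l1).
Qed.

Lemma ln_enorm_lt (M : R) x : x != 0 -> enorm x < expR (- M) -> M < - ln (enorm x).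
Proof.
by move=> x0 xM; rewrite ltrNr -(expRK (- M)) ltr_ln ?posrE ?expR_gt0// enorm_gt0.
Qed.

Lemma u_log_gt_near0 delta (M : R) : 0 < delta -> exists2 r, 0 < r <= expR (-1) &
  forall x, x != 0 -> enorm x < r -> M < u_log delta x.
Proof.
(* [N] is chosen so that its power [delta] is [|M| + 1]; the maximum with 1 keeps the radius below
   1/e. *)
move=> d0; pose N := (`|M| + 1) `^ delta^-1; pose K := Num.max N 1.
exists (expR (- K)).
  by rewrite expR_gt0 ler_expR lerN2 le_max lexx orbT.
move=> x x0 xr; have lK := ln_enorm_lt x0 xr.
have NK : N < - ln (enorm x) by rewrite (le_lt_trans _ lK)// le_max lexx.
apply: (@lt_trans _ _ (`|M| + 1)); first by rewrite ltr_pwDr// ler_norm.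
have -> : `|M| + 1 = N `^ delta.
  by rewrite /N -powRrM mulVf ?gt_eqF// powRr1// addr_ge0.
by rewrite /u_log gt0_ltr_powR ?nnegrE ?powR_ge0//; rewrite ltW// (le_lt_trans _ NK)// powR_ge0.
Qed.

(** [u_log delta] is the inverse of [u_log (- delta)], which blows up. The origin may be included
    because a nonzero power of 0 is 0. *)
Lemma u_log_lt_near0 delta (e : R) : delta < 0 -> 0 < e -> exists2 r, 0 < r <= expR (-1) &
  forall x, enorm x < r -> u_log delta x < e.
Proof.
move=> d0 e0; have d0' : 0 < - delta by rewrite oppr_gt0.
have [r r0 rP] := u_log_gt_near0 e^-1 d0'; exists r => // x xr.
have [->|x0] := eqVneq x 0.
  by rewrite /u_log enorm0 ln0// oppr0 powR0// lt_eqF.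
have xB : B x by rewrite /eball/= (lt_le_trans xr)//; case/andP: r0.
rewrite -[e]invrK -[delta]opprK /u_log powRN ltf_pV2 ?posrE ?invr_gt0//.
  exact: rP.
exact: u_log_gt0.
Qed.

Lemma near0_enorm r : 0 < r -> \forall x \near (0 : 'rV[R]_n)^', enorm x < r.
Proof.
move=> r0; have e0 : @eball R n r 0 by rewrite /eball/= enorm0.
have H : nbhs (0 : 'rV[R]_n) (eball r) by apply: open_nbhs_nbhs; split => //; exact: open_eball.
exact: (nbhs_dnbhs H).
Qed.

Lemma u_log_cvgy delta : 0 < delta -> u_log delta x @[x --> (0 : 'rV[R]_n)^'] --> +oo.
Proof.
move=> d0; apply/cvgryPgt => M; have [r /andP[r0 _] rP] := u_log_gt_near0 M d0.
near=> x; apply: rP; first by near: x; exact: nbhs_dnbhs_neq.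
by near: x; exact: near0_enorm.
Unshelve. all: by end_near. Qed.

Lemma u_log_cvg0 delta : delta < 0 -> u_log delta x @[x --> (0 : 'rV[R]_n)^'] --> (0 : R).
Proof.
move=> d0; apply/cvgrPdist_lt => e e0; have [r /andP[r0 _] rP] := u_log_lt_near0 d0 e0.
near=> x; rewrite sub0r normrN ger0_norm ?powR_ge0//; apply: rP.
by near: x; exact: near0_enorm.
Unshelve. all: by end_near. Qed.

(** Balls have positive measure and the origin has none. Statements on essential bounds are refuted
    by evaluating at the point obtained, which avoids the origin where the pointwise estimates may
    fail. *)
Lemma ae_eball_exists (P : 'rV[R]_n -> Prop) r : 0 < r ->
  {ae mu, forall x, P x} -> exists x, [/\ enorm x < r, x != 0 & P x].
Proof.
move=> r0 [N [mN N0 PN]]; apply: contrapT => nex.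
pose Z : set 'rV[R]_n := [set 0].
have : (mu (eball r) <= mu (N `|` Z))%E.
  apply: le_measure; rewrite ?inE; first exact: measurable_eball.
    by apply: measurableU => //; exact: measurable_row_set1.
  move=> x xr; have [->|x0] := eqVneq x 0; [by right|left].
  by apply: PN => Px; apply: nex; exists x.
rewrite null_set_setU//; last 2 first.
- exact: measurable_row_set1.
- by apply: lebesgue_row_set0; exact: leq_trans n3.
by rewrite leNgt eball_gt0.
Qed.

End log_behaviour.

(** * Flat functions built from [expR (- t^-1)] *)

Section bump.
Context {R : realType}.
Implicit Types (t : R) (m : nat).

(** The index [m] is there for closure under differentiation: the derivative of a member is a
    combination of [bump m.+1] and [bump m.+2]. *)
Definition bump m t : R := if 0 < t then t ^- m * expR (- t^-1) else 0.

Lemma expRN_pow_le (k : nat) (y : R) : (0 < k)%N -> 0 < y -> y ^+ k * expR (- y) <= k%:R ^+ k.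
Proof.
move=> k0 y0; have k0' : 0 < k%:R :> R by rewrite ltr0n.
have : (y / k%:R) ^+ k <= expR y.
  have {2}-> : y = k%:R * (y / k%:R) by rewrite mulrC divfK// gt_eqF.
  rewrite expRM_natl lerXn2r ?nnegrE ?expR_ge0//.
    by rewrite divr_ge0 ?ltW.
  by apply: le_trans (expR_ge1Dx _); rewrite lerDr.
rewrite expr_div_n ler_pdivrMr ?exprn_gt0// => h.
by rewrite expRN ler_pdivrMr ?expR_gt0// mulrC.
Qed.

(** Quadratic decay at 0 suffices for a zero derivative there. It is [expRN_pow_le] at [y = t^-1],
    with two powers more than [m]. *)
Lemma bump_le m t : `|bump m t| <= m.+2%:R ^+ m.+2 * t ^+ 2.
Proof.
rewrite /bump; case: ifPn => t0; last by rewrite normr0 mulr_ge0 ?sqr_ge0// exprn_ge0.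
rewrite ger0_norm ?mulr_ge0 ?invr_ge0 ?exprn_ge0 ?expR_ge0 ?(ltW t0)//.
rewrite -ler_pdivrMr ?exprn_gt0//.
have t1 : 0 < t^-1 by rewrite invr_gt0.
apply: le_trans (expRN_pow_le (isT : (0 < m.+2)%N) t1).
by rewrite mulrAC -exprVn -exprVn -exprD addn2.
Qed.

Lemma is_derive_bump m t :
  is_derive t (1 : R) (bump m) (- m%:R * bump m.+1 t + bump m.+2 t).
Proof.
have [t0|t0|t0] := ltgtP 0 t.
- have tn0 : t != 0 by rewrite gt_eqF.
  have di := is_deriveV (tn0 : id t != 0) (is_derive_id t (1 : R)).
  have dX := is_deriveX m di.
  have dE := @is_derive1_comp _ expR (- (fun y : R => y^-1)) t _ _ (is_derive_expR _) (is_deriveN di).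
  apply: (@near_eq_is_derive _ _ _ ((fun y : R => y^-1) ^+ m * (expR \o (- (fun y : R => y^-1))))).
    near=> y; have y0 : 0 < y by near: y; exact: lt_nbhsr.
    by rewrite /bump y0 /= !fctE exprVn.
  apply: (is_derive_eq (is_deriveM dX dE)).
  rewrite /bump t0 /GRing.scale/= !fctE.
  rewrite -!exprVn; move: (expR _) => e; case: m {dX} => [|m] /=.
    by move: (t^-1) => a; ring.
  rewrite !exprS; move: (t^-1) => a; move: (a ^+ m) => b.
  by rewrite -[1 *- m.+1]/(- (m.+1%:R)); move: (m.+1%:R) => c; ring.
- apply: (@near_eq_is_derive _ _ _ (cst 0 : R -> R)).
    near=> y; have y0 : y < 0 by near: y; exact: lt_nbhsl.
    by rewrite /bump ltNge (ltW y0).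
  by rewrite /bump ltNge (ltW t0)/= mulr0 addr0; exact: is_derive_cst.
- rewrite -t0 /bump ltxx mulr0 addr0.
  have cv : (fun h : R => h^-1 *: ((bump m \o shift 0) (h *: (1 : R)) - bump m 0)) @ 0^' --> (0 : R).
    apply/cvgrPdist_lt => e e0; near=> h.
    have h0 : h != 0 by near: h; exact: nbhs_dnbhs_neq.
    rewrite /= addr0 -[h *: 1]/(h * 1) mulr1 {2}/bump ltxx subr0 sub0r normrN.
    rewrite -[_ *: _]/(_ * _) normrM normfV.
    apply: (@le_lt_trans _ _ (m.+2%:R ^+ m.+2 * `|h|)).
      rewrite ler_pdivrMl ?normr_gt0// mulrCA -expr2 real_normK ?num_real//.
      exact: bump_le.
    rewrite -ltr_pdivlMl ?exprn_gt0//.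
    near: h; apply: dnbhs0_lt.
    by rewrite mulr_gt0// invr_gt0 exprn_gt0.
  by split; [apply/cvg_ex; exists 0|exact: cvg_lim].
Unshelve. all: by end_near. Qed.

End bump.

(** * A class of formulas closed under partial derivatives *)

Section smooth_expressions.
Context {R : realType} {n : nat}.
Implicit Types (f g phi : 'rV[R]_n -> R) (U : set 'rV[R]_n).
Local Notation e_ i := (delta_mx ord0 i : 'rV[R]_n).

(* Functions given on U by an elementary formula; the class is stable under
   partial derivatives, so that its members are smooth on U. *)
Inductive smooth_expr U : ('rV[R]_n -> R) -> Prop :=
| smooth_cst c : smooth_expr U (cst c)
| smooth_coord i : smooth_expr U (fun x => x ord0 i)
| smooth_add f g : smooth_expr U f -> smooth_expr U g -> smooth_expr U (f + g)
| smooth_mul f g : smooth_expr U f -> smooth_expr U g -> smooth_expr U (f * g)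
| smooth_inv f : (forall x, U x -> f x != 0) -> smooth_expr U f ->
    smooth_expr U (GRing.inv \o f)
| smooth_exp f : smooth_expr U f -> smooth_expr U (@expR R \o f)
| smooth_ln f : (forall x, U x -> 0 < f x) -> smooth_expr U f -> smooth_expr U (@ln R \o f)
| smooth_bump m f : smooth_expr U f -> smooth_expr U (bump m \o f).

Lemma smooth_expr_derive U f : smooth_expr U f ->
  (forall x, U x -> {for x, continuous f}) /\
  forall i, exists2 g, smooth_expr U g & forall x, U x -> is_derive x (e_ i) f (g x).
Proof.
(* One chain rule serves the four unary constructors; each of them only has to exhibit its
   derivative inside the class. *)
have comp1 (h h' : R -> R) g : smooth_expr U g -> smooth_expr U (h' \o g) ->
    (forall x, U x -> is_derive (g x) (1 : R) h (h' (g x))) ->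
    (forall x, U x -> {for x, continuous g}) /\
    (forall i, exists2 g', smooth_expr U g' & forall x, U x -> is_derive x (e_ i) g (g' x)) ->
    (forall x, U x -> {for x, continuous (h \o g)}) /\
    (forall i, exists2 g', smooth_expr U g' & forall x, U x -> is_derive x (e_ i) (h \o g) (g' x)).
  move=> sg sh' dh [cg dg]; split=> [x Ux|i].
    apply: continuous_comp; [exact: cg|exact: is_derive1_continuous (dh x Ux)].
  have [g' sg' dg'] := dg i; exists ((h' \o g) * g'); first exact: smooth_mul.
  by move=> x Ux; exact: is_derive_chain (dg' x Ux) (dh x Ux).
elim=> {f}.
- move=> c; split=> [x _|i]; first exact: cst_continuous.
  by exists (cst 0) => [|x _]; [exact: smooth_cst|exact: is_derive_cst].
- move=> j; split=> [x _|i]; first exact: coord_continuous.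
  exists (cst (j == i)%:R) => [|x _]; [exact: smooth_cst|exact: is_derive_coord].
- move=> f g sf [cf df] sg [cg dg]; split=> [x Ux|i].
    by apply: continuousD; [exact: cf|exact: cg].
  have [f' sf' df'] := df i; have [g' sg' dg'] := dg i.
  exists (f' + g'); first exact: smooth_add.
  by move=> x Ux; exact: is_deriveD (df' x Ux) (dg' x Ux).
- move=> f g sf [cf df] sg [cg dg]; split=> [x Ux|i].
    by apply: continuousM; [exact: cf|exact: cg].
  have [f' sf' df'] := df i; have [g' sg' dg'] := dg i.
  exists (f * g' + g * f'); first by apply: smooth_add; exact: smooth_mul.
  by move=> x Ux; exact: is_deriveM (df' x Ux) (dg' x Ux).
- move=> f f0 sf; apply: (comp1 _ (fun y => -1 * (y^-1 * y^-1))) => // [|x Ux].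
    have si := smooth_inv f0 sf.
    exact: (smooth_mul (smooth_cst U (-1)) (smooth_mul si si)).
  apply: (is_derive_eq (is_deriveV (f0 x Ux : id (f x) != 0) (is_derive_id _ _))).
  by rewrite /GRing.scale/= mulr1 mulN1r expr2 invfM.
- move=> f sf; apply: (comp1 _ expR) => //; exact: smooth_exp.
- move=> f f0 sf; apply: (comp1 _ GRing.inv) => // [|x Ux].
    by apply: smooth_inv => // x Ux; rewrite gt_eqF// f0.
  exact/is_derive1_ln/f0.
- move=> m f sf; apply: (comp1 _ (fun y => - m%:R * bump m.+1 y + bump m.+2 y)) => // [|x Ux].
    have s1 := smooth_bump m.+1 sf; have s2 := smooth_bump m.+2 sf.
    exact: (smooth_add (smooth_mul (smooth_cst U (- m%:R)) s1) s2).
  exact: is_derive_bump.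
Qed.

(** By induction on the list of directions, every iterated partial derivative agrees on [U] with a
    member of the class. The formula may change from one open set to another, as needed for
    functions defined by cases. *)
Lemma smooth_local phi :
  (forall x, exists U, [/\ open U, U x &
    exists2 f, smooth_expr U f & forall y, U y -> phi y = f y]) -> smooth phi.
Proof.
move=> H.
have nearU U x : open U -> U x -> \forall y \near x, U y.
  by move=> oU Ux; exact: open_nbhs_nbhs.
have iter s U : open U -> (exists2 f, smooth_expr U f & forall y, U y -> phi y = f y) ->
    exists2 f, smooth_expr U f & forall y, U y -> foldr partial phi s y = f y.
  move=> oU; elim: s => // i s IH /IH[f sf sE].
  have [_ /(_ i)[f' sf' df']] := smooth_expr_derive sf.
  exists f' => // y Uy /=; rewrite /partial (@near_eq_derive _ _ _ _ f).
    by have [_ ->] := df' y Uy.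
  by near=> z; apply: sE; near: z; exact: nearU.
move=> s; split=> [x|i x]; have [U [oU Ux /(iter s U oU)[f sf sE]]] := H x;
  have [cf df] := smooth_expr_derive sf.
- apply: (@continuous_near _ _ _ f); last exact: cf.
  by near=> z; apply/esym/sE; near: z; exact: nearU.
- have [f' _ df'] := df i; have [d _] := df' x Ux.
  apply: near_eq_derivable d.
  by near=> z; apply/esym/sE; near: z; exact: nearU.
Unshelve. all: by end_near. Qed.

End smooth_expressions.

(** * A smooth positive part *)

Section smooth_truncation.
Context {R : realType}.
Implicit Types (k w : R).

(* A smooth approximation of the positive part [Num.max w 0], exact in the
   limit k -> +oo, with derivative in [0, 1]. *)
Definition spos k w : R := w * bump 0 (k * w).
Definition dspos k w : R := bump 0 (k * w) + k * w * bump 2 (k * w).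

Lemma is_derive_spos k w : is_derive w (1 : R) (spos k) (dspos k w).
Proof.
have dm := is_deriveZ k (is_derive_id w (1 : R)).
have db := @is_derive1_comp _ (bump 0) (k \*: id) w _ _ (is_derive_bump 0 (k * w)) dm.
apply: (is_derive_eq (is_deriveM (is_derive_id w (1 : R)) db)).
rewrite /dspos /GRing.scale/= /GRing.scale/=.
by ring.
Qed.

Lemma bump0_itv t : 0 <= (bump 0 t : R) <= 1.
Proof.
rewrite /bump expr0 invr1 mul1r; case: ifPn => [t0|_]; last by rewrite lexx ler01.
by rewrite expR_ge0 expR_le1 oppr_le0 invr_ge0 ltW.
Qed.

Lemma spos_le0 k w : 0 < k -> w <= 0 -> spos k w = 0 /\ dspos k w = 0.
Proof.
move=> k0 w0; have kw : (0 < k * w) = false by rewrite pmulr_rgt0// ltNge w0.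
by rewrite /spos /dspos /bump kw !mulr0 addr0.
Qed.

Lemma spos_gt0 k w : 0 < k -> 0 < w ->
  spos k w = w * expR (- (k * w)^-1) /\
  dspos k w = expR (- (k * w)^-1) * (1 + (k * w)^-1).
Proof.
move=> k0 w0; have kw : 0 < k * w by rewrite mulr_gt0.
rewrite /spos /dspos /bump kw expr0 invr1 mul1r; split => //.
by move: (expR _) => e; field; rewrite !gt_eqF.
Qed.

Lemma spos_itv k w : 0 < k -> 0 < w -> 0 <= spos k w <= w.
Proof.
move=> k0 w0; have /andP[b0 b1] := bump0_itv (k * w).
by rewrite /spos mulr_ge0 ?(ltW w0)// ler_piMr// ltW.
Qed.

(** With [y = (k w)^-1] the upper bound is [1 + y <= expR y]. It lets the gradients of the
    approximants be dominated uniformly in [k]. *)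
Lemma dspos_itv k w : 0 < k -> 0 <= dspos k w <= 1.
Proof.
move=> k0; have [w0|w0] := leP w 0.
  by have [_ ->] := spos_le0 k0 w0; rewrite lexx ler01.
have [_ ->] := spos_gt0 k0 w0; have y0 : 0 <= (k * w)^-1.
  by rewrite invr_ge0 ltW// mulr_gt0.
rewrite mulr_ge0 ?expR_ge0//=; last by rewrite addr_ge0.
by rewrite expRN mulrC ler_pdivrMr ?expR_gt0// mul1r expR_ge1Dx.
Qed.

End smooth_truncation.

(** * Approximants of [u - 1] by test functions *)

Section approximation.
Context {R : realType} {n : nat}.
Variables (delta : R).
Hypothesis d01 : 0 < delta < 1.
Implicit Types (eps k : R) (x : 'rV[R]_n).
Local Notation mu := (@lebesgue_row R n).
Local Notation e_ i := (delta_mx ord0 i : 'rV[R]_n).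
Local Notation B := (eball (expR (-1)) : set 'rV[R]_n).

Let d0 : 0 < delta. Proof. by case/andP: d01. Qed.
Let d11 : -1 < delta < 1.
Proof. by case/andP: d01 => d0' ->; rewrite (lt_trans _ d0')// ltrN10. Qed.

Definition approx eps k x : R := spos k (plog delta (dot x x + eps) - 1).

(** The bound must also hold for [s >= 1], since the approximants have to vanish outside the ball.
    There [mlog s] is nonpositive and the power takes a default value: 1 for a negative base, 0 for
    a zero base. *)
Lemma plog_le1 s : expR (-2) <= s -> plog delta s <= 1.
Proof.
move=> hs; have s0 : 0 < s by rewrite (lt_le_trans _ hs)// expR_gt0.
have m1 : mlog s <= 1.
  have : -2 <= ln s by rewrite -(expRK (-2)) ler_ln// posrE expR_gt0.
  by rewrite /mlog; lra.
have p1 : 1 `^ delta = 1 :> R by rewrite powR1.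
rewrite /plog; have [m0|m0|<-] := ltgtP 0 (mlog s).
- by rewrite -[leRHS]p1; apply: ge0_ler_powR; rewrite ?nnegrE// ltW.
- by rewrite lt0_powR1.
- by rewrite powR0 ?ler01// gt_eqF.
Qed.

Lemma plog_gt1 s : 0 < s < expR (-2) -> 1 < plog delta s.
Proof.
move=> /mlog_gt1 m1; have <- : 1 `^ delta = 1 :> R by rewrite powR1.
by rewrite /plog gt0_ltr_powR// nnegrE ltW// (lt_trans _ m1).
Qed.

Lemma approx_vanish eps k x : 0 < k -> expR (-2) <= dot x x + eps -> approx eps k x = 0.
Proof.
by move=> k0 hs; apply: (spos_le0 k0 _).1; rewrite subr_le0 plog_le1.
Qed.

Lemma continuous_dot_add eps : continuous ((fun x => dot x x + eps) : 'rV[R]_n -> R).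
Proof. move=> x; have c1 := @dot_continuous R n x; have c2 := @cst_continuous _ _ eps x.
exact: (continuousD c1 c2). Qed.

Lemma open_dot_lt eps c : open [set x : 'rV[R]_n | dot x x + eps < c].
Proof.
apply: (@open_comp _ _ (fun x : 'rV[R]_n => dot x x + eps) [set y | y < c]); last exact: open_lt.
by move=> x _; exact: continuous_dot_add.
Qed.

Lemma open_dot_gt eps c : open [set x : 'rV[R]_n | c < dot x x + eps].
Proof.
apply: (@open_comp _ _ (fun x : 'rV[R]_n => dot x x + eps) [set y | c < y]); last exact: open_gt.
by move=> x _; exact: continuous_dot_add.
Qed.

Lemma smooth_dot (U : set 'rV[R]_n) : smooth_expr U (fun x => dot x x).
Proof.
have -> : (fun x => dot x x) = \sum_(j < n) ((fun y : 'rV[R]_n => y ord0 j) * (fun y => y ord0 j)).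
  by apply/funext => y; rewrite fct_sumE.
elim/big_ind : _ => [|f g|i _]; [exact: smooth_cst|exact: smooth_add|].
by apply: smooth_mul; exact: smooth_coord.
Qed.

(** Two open sets cover the space because [expR (-2) < 1]: on [dot x x + eps < 1] the function is an
    elementary formula, on [dot x x + eps > expR (-2)] it is zero. *)
Lemma approx_smooth eps k : 0 < eps -> 0 < k -> smooth (approx eps k).
Proof.
move=> e0 k0; apply: smooth_local => x.
have [xs|xs] := ltP (dot x x + eps) 1; last first.
  exists [set x | expR (-2) < dot x x + eps]; split.
  - exact: open_dot_gt.
  - by rewrite /= (lt_le_trans _ xs)// expRN2_lt1.
  - exists (cst 0); first exact: smooth_cst.
    by move=> y /= /ltW ys; rewrite approx_vanish.
pose U : set 'rV[R]_n := [set x | dot x x + eps < 1].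
have U01 y : U y -> 0 < dot y y + eps < 1.
  by move=> Uy; rewrite Uy andbT ltr_wpDl// dot_ge0.
exists U; split => //; first exact: open_dot_lt.
have sS : smooth_expr U ((fun x => dot x x) + cst eps).
  by apply: smooth_add; [exact: smooth_dot|exact: smooth_cst].
have sm : smooth_expr U (cst (- 2^-1) * (@ln R \o ((fun x => dot x x) + cst eps))).
  apply: smooth_mul; first exact: smooth_cst.
  by apply: smooth_ln => // y /U01/andP[].
have mE y : (cst (- 2^-1) * (@ln R \o ((fun x => dot x x) + cst eps))) y = mlog (dot y y + eps).
  by rewrite /mlog /= !fctE mulNr mulrC.
(* The real power is written as the exponential of [delta] times a logarithm, which is legitimate
   since [mlog] is positive on [U]. *)
have sp : smooth_expr U (@expR R \o (cst delta * (@ln R \o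
    (cst (- 2^-1) * (@ln R \o ((fun x => dot x x) + cst eps)))))).
  apply: smooth_exp; apply: smooth_mul; first exact: smooth_cst.
  by apply: smooth_ln => // y /U01 y01; rewrite mE mlog_gt0.
have sw := smooth_add sp (smooth_cst U (-1)).
eexists; first exact: (smooth_mul sw (smooth_bump 0 (smooth_mul (smooth_cst U k) sw))).
move=> y /U01 y01; rewrite /approx /spos.
have -> : plog delta (dot y y + eps) - 1 = ((@expR R \o (cst delta * (@ln R \o
    (cst (- 2^-1) * (@ln R \o ((fun x => dot x x) + cst eps)))))) + cst (-1)) y.
  by rewrite /plog /powR gt_eqF ?mlog_gt0// -mE.
by [].
Qed.

Lemma approx_test_function eps k : 0 < eps -> 0 < k -> test_function B (approx eps k).
Proof.
move=> e0 k0; split; first exact: approx_smooth.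
pose K : set 'rV[R]_n := ~` [set x | expR (-2) < dot x x + eps].
have KB : K `<=` B.
  move=> x /negP; rewrite -leNgt => xs; rewrite /eball/=.
  rewrite -(@ltr_pXn2r _ 2) ?nnegrE ?enorm_ge0 ?expR_ge0// enorm_sqr -expRM_natl.
  rewrite (_ : 2%:R * -1 = -2); last by ring.
  by rewrite (lt_le_trans _ xs)// ltrDl.
exists K; split => //.
- apply: bounded_closed_compact; last by apply: open_closedC; exact: open_dot_gt.
  exists 1; split; first exact: num_real.
  move=> M M1 x /KB xB; rewrite /= [leLHS]mx_normrE; apply/bigmax_leP; split.
    by rewrite ltW// (lt_trans _ M1).
  move=> [i j] _ /=; rewrite [i]ord1 (le_trans (coord_enorm x j))// ltW// (lt_trans _ M1)//.
  by apply: lt_trans expRN1_lt1.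
- by move=> x /contrapT/= /ltW xs; rewrite approx_vanish.
Qed.

(** Independence of [eps] and [k] provides the majorant for dominated convergence. *)
Lemma approx_le eps k x : 0 < eps -> 0 < k -> x != 0 ->
  0 <= approx eps k x <= (enorm x)^-1.
Proof.
move=> e0 k0 x0; have en0 : 0 < enorm x by rewrite enorm_gt0.
have [xs|xs] := ltP (dot x x + eps) (expR (-2)); last first.
  by rewrite approx_vanish// lexx invr_ge0 ltW.
have s0 : 0 < dot x x + eps by rewrite ltr_wpDl// dot_ge0.
have sI : 0 < dot x x + eps < expR (-2) by rewrite s0.
have w0 : 0 < plog delta (dot x x + eps) - 1 by rewrite subr_gt0 plog_gt1.
have /andP[-> h] := spos_itv k0 w0; rewrite /= (le_trans h)//.
apply: (@le_trans _ _ (plog delta (dot x x + eps))); first by rewrite gerBl.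
have d1 : delta <= 1 by case/andP: d01 => _ /ltW.
apply: (le_trans (plog_le d1 sI)).
rewrite lef_pV2; first by rewrite /enorm ler_sqrt ?lerDl ltW.
  by rewrite posrE sqrtr_gt0.
by rewrite posrE.
Qed.

Lemma approx_partial eps k x i : 0 < eps -> 0 < k -> dot x x + eps < 1 ->
  partial i (approx eps k) x =
  dspos k (plog delta (dot x x + eps) - 1) * (plog1 delta (dot x x + eps) * (2 * x ord0 i)).
Proof.
move=> e0 k0 xs; have s0 : 0 < dot x x + eps by rewrite ltr_wpDl// dot_ge0.
have s01 : 0 < dot x x + eps < 1 by rewrite s0.
have ds := is_deriveD (is_derive_dot x i) (is_derive_cst eps x (e_ i)).
have dp := is_derive_chain ds (is_derive_plog delta s01).
have dw := is_deriveD dp (is_derive_cst (-1 : R) x (e_ i)).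
have de := is_derive_chain dw (is_derive_spos k _).
have [_] := de; rewrite !addr0; apply.
Qed.

Lemma approx_partial_le eps k x i : 0 < eps -> 0 < k -> x != 0 ->
  `|partial i (approx eps k) x| <= (enorm x)^-1.
Proof.
move=> e0 k0 x0; have en0 : 0 < enorm x by rewrite enorm_gt0.
have s0 : 0 < dot x x + eps by rewrite ltr_wpDl// dot_ge0.
have [s1|s1] := leP 1 (dot x x + eps).
  have -> : partial i (approx eps k) x = 0; last by rewrite normr0 invr_ge0 ltW.
  rewrite /partial (@near_eq_derive _ _ _ _ (cst 0)) ?derive_cst//.
  have xU : expR (-2) < dot x x + eps by rewrite (lt_le_trans _ s1)// expRN2_lt1.
  have H : nbhs x [set y : 'rV[R]_n | expR (-2) < dot y y + eps].
    by apply: open_nbhs_nbhs; split => //; exact: open_dot_gt.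
  near=> y; rewrite approx_vanish//; apply: ltW.
  by near: y; exact: H.
have [xs|xs] := ltP (dot x x + eps) (expR (-2)); last first.
  have [|_ ds0] := @spos_le0 _ k (plog delta (dot x x + eps) - 1) k0.
    by rewrite subr_le0 plog_le1.
  by rewrite approx_partial// ds0 mul0r normr0 invr_ge0 ltW.
rewrite approx_partial// normrM.
have sI : 0 < dot x x + eps < expR (-2) by rewrite s0.
have /andP[ds0 ds1] := dspos_itv (plog delta (dot x x + eps) - 1) k0.
rewrite (ger0_norm ds0) (le_trans (ler_piMl _ ds1))//.
rewrite (normrM (plog1 _ _)) (normrM 2) (ger0_norm (ler0n _ 2)).
apply: (@le_trans _ _ ((2 * (dot x x + eps))^-1 * (2 * enorm x))).
  apply: ler_pM; rewrite ?mulr_ge0//; first exact: plog1_le.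
  by rewrite ler_pM2l// coord_enorm.
have -> : (2 * (dot x x + eps))^-1 * (2 * enorm x) = enorm x / (dot x x + eps).
  by field; rewrite gt_eqF.
rewrite ler_pdivrMr// mulrC ler_pdivlMr// -expr2 enorm_sqr.
by rewrite lerDl ltW.
Unshelve. all: by end_near. Qed.

End approximation.

(** * Boundary values in the Sobolev sense *)

Section boundary_values.
Context {R : realType} {n : nat}.
Variables (delta : R).
Hypotheses (n3 : (3 <= n)%N) (d01 : 0 < delta < 1).
Implicit Types (x : 'rV[R]_n).
Local Notation mu := (@lebesgue_row R n).
Local Notation e_ i := (delta_mx ord0 i : 'rV[R]_n).
Local Notation B := (eball (expR (-1)) : set 'rV[R]_n).

Let d11 : -1 < delta < 1.
Proof. by case/andP: d01 => d0' ->; rewrite (lt_trans _ d0')// ltrN10. Qed.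

Definition excess x : R := Num.max (`|u_log delta x| - 1) 0.

(** A positive exponent makes [u] exceed 1 in the whole punctured ball, so the truncation is
    inactive and the excess has the gradient of [u]. *)
Lemma excessE x : B x -> x != 0 -> excess x = u_log delta x - 1.
Proof.
move=> xB x0; have u1 : 1 < u_log delta x.
  by rewrite u_logE plog_gt1// eball_dot.
by rewrite /excess ger0_norm ?powR_ge0// max_l// subr_ge0 ltW.
Qed.

Lemma near_excess x : B x -> x != 0 -> \forall y \near x, u_log delta y - 1 = excess y.
Proof.
move=> xB x0; have H : nbhs x (B `\ 0).
  apply: open_nbhs_nbhs; split; last by split => //; apply/eqP.
  apply: openI; first exact: open_eball.
  by apply: closed_openC; exact: closed_row_set1.
by apply: filterS H => y [yB /eqP y0]; rewrite excessE.
Qed.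

Lemma continuous_excess x : B x -> x != 0 -> {for x, continuous excess}.
Proof.
move=> xB x0; apply: (continuous_near (near_excess xB x0)).
have c1 := @continuous_u_log R n delta x xB x0; have c2 := @cst_continuous 'rV[R]_n R (-1) x.
exact: (continuousD c1 c2).
Qed.

Lemma is_derive_excess x i : B x -> x != 0 ->
  is_derive x (e_ i) excess (Glog delta x ord0 i).
Proof.
move=> xB x0; apply: (near_eq_is_derive (near_excess xB x0)).
apply: (is_derive_eq (is_deriveB (@is_derive_u_log _ _ delta x i xB x0) (is_derive_cst (1 : R) x (e_ i)))).
by rewrite subr0.
Qed.

Lemma excess_itv x : B x -> x != 0 -> 0 <= excess x <= (enorm x)^-1.
Proof.
move=> xB x0; rewrite /excess le_max lexx orbT/= -/(excess x) excessE//.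
by rewrite (le_trans _ (u_log_le d11 xB x0))// gerBl.
Qed.

Lemma sqr_inv_enorm_le (a : R) x : 0 <= a <= (enorm x)^-1 -> a ^+ 2 <= 1 / enorm x ^+ 2.
Proof.
move=> /andP[a0 a1]; rewrite div1r -exprVn lerXn2r ?nnegrE//.
exact: le_trans a1.
Qed.

Lemma W12_grad_excess : W12_grad B excess (Glog delta).
Proof.
have [_ HG _] := W12_grad_u_log n3 d11.
split => //.
  apply: (@in_L2_le _ _ n3 _ 1).
    apply: measurable_fun_punctured; first exact: open_eball.
    by move=> x xB x0; exact: continuous_excess.
  by move=> x xB x0; apply: sqr_inv_enorm_le; exact: excess_itv.
move=> phi i tphi.
have [] := @integration_by_parts_punctured R n n3 _ i 17 excess
  (fun x => Glog delta x ord0 i) phi (ltW expRN1_lt1) tphi => //.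
- by move=> x xB x0; exact: is_derive_excess.
- by move=> x xB x0; exact: continuous_excess.
- by move=> x xB x0; exact: continuous_Glog.
- move=> x xB x0; have /andP[h0 h1] := excess_itv xB x0.
  rewrite ger0_norm// (le_trans h1)// (le_trans (inv_enorm_le xB x0))//.
  by rewrite ler_wpM2r ?invr_ge0 ?exprn_ge0 ?enorm_ge0// ler1n.
- by move=> x xB x0; exact: Glog_le_inv_sqr.
Qed.

Let phi_ (k : nat) : 'rV[R]_n -> R := approx delta k.+1%:R^-1 k.+1%:R.

Let tphi k : test_function B (phi_ k).
Proof. by apply: approx_test_function => //; rewrite invr_gt0. Qed.

(** A single index sends [eps = k.+1^-1] to 0 and the truncation parameter [k.+1] to infinity. At a
    fixed point [w k] tends to [w0 > 0], so [y k] tends to 0 and the truncation factors [expR (- y)]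
    and [expR (- y) * (1 + y)] tend to 1. *)
Lemma approx_cvg x : B x -> x != 0 ->
  (phi_ k x @[k --> \oo] --> excess x) /\
  forall i, partial i (phi_ k) x @[k --> \oo] --> Glog delta x ord0 i.
Proof.
move=> xB x0; have sI := eball_dot xB x0; have sI1 := eball_dot1 xB x0.
have s0 : 0 < dot x x by case/andP: sI.
pose eps (k : nat) : R := k.+1%:R^-1; pose s k := dot x x + eps k.
have cs : s k @[k --> \oo] --> dot x x.
  rewrite -[X in _ --> X]addr0; apply: cvgD; first exact: cvg_cst.
  exact: cvg_harmonic.
have cp : plog delta (s k) @[k --> \oo] --> plog delta (dot x x).
  apply: (cvg_comp _ _ cs); exact: (is_derive1_continuous (is_derive_plog delta sI1)).
have cp1 : plog1 delta (s k) @[k --> \oo] --> plog1 delta (dot x x).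
  apply: (cvg_comp _ _ cs); exact: (is_derive1_continuous (is_derive_plog1 delta sI1)).
pose w k := plog delta (s k) - 1; pose w0 := plog delta (dot x x) - 1.
have cw : w k @[k --> \oo] --> w0 by apply: cvgB => //; exact: cvg_cst.
have w0_gt0 : 0 < w0 by rewrite subr_gt0; exact: plog_gt1.
pose y k := (k.+1%:R * w k)^-1.
have cy : y k @[k --> \oo] --> (0 : R).
  rewrite -(mul0r w0^-1).
  rewrite (_ : (fun k => y k) = (fun k => eps k * (w k)^-1)); last first.
    by apply/funext => k; rewrite /y invfM.
  apply: cvgM; first exact: cvg_harmonic.
  by apply: cvgV => //; rewrite gt_eqF.
have ce : expR (- y k) @[k --> \oo] --> (1 : R).
  rewrite -(@expR0 R) -[X in expR X]oppr0.
  by apply: (cvg_comp _ _ (cvgN cy)); exact: continuous_expR.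
have s_lt : \forall k \near \oo, s k < 1.
  by apply: (cvgr_lt (dot x x)) => //; case/andP: sI1.
have w_gt : \forall k \near \oo, 0 < w k by apply: (cvgr_gt w0).
have k0 k : 0 < k.+1%:R :> R by rewrite ltr0n.
have e0 k : 0 < eps k by rewrite /eps invr_gt0.
split=> [|i].
  rewrite excessE// u_logE -/w0 -[w0]mulr1.
  apply: (cvg_trans _ (cvgM cw ce)); apply: near_eq_cvg.
  near=> k; have wk : 0 < w k by near: k.
  by have [h _] := spos_gt0 (k0 k) wk; rewrite /phi_ /approx -/(eps k) -/(s k) -/(w k) h.
have -> : Glog delta x ord0 i = 1 * (1 + 0) * (plog1 delta (dot x x) * (2 * x ord0 i)).
  by rewrite /Glog mxE; ring.
have c1 : 1 + y k @[k --> \oo] --> 1 + (0 : R) by apply: cvgD => //; exact: cvg_cst.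
have c2 : plog1 delta (s k) * (2 * x ord0 i) @[k --> \oo] -->
    plog1 delta (dot x x) * (2 * x ord0 i) by apply: cvgM => //; exact: cvg_cst.
apply: (cvg_trans _ (cvgM (cvgM ce c1) c2)); apply: near_eq_cvg.
near=> k; have wk : 0 < w k by near: k.
have sk : s k < 1 by near: k.
have [_ h] := spos_gt0 (k0 k) wk.
by rewrite /phi_ approx_partial// -/(eps k) -/(s k) -/(w k) h.
Unshelve. all: by end_near. Qed.

Lemma W12_0_excess : W12_0 B excess.
Proof.
exists (Glog delta); first exact: W12_grad_excess.
move=> e e0; have mB := @measurable_eball R n (expR (-1)).
pose g k x := (phi_ k x - excess x) ^+ 2 + enorm (grad (phi_ k) x - Glog delta x) ^+ 2.
(* One contribution [4 |x|^-2] from the square of the difference of functions, and one from each of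
   the [n] partial derivatives. *)
pose C : R := 4 + 4 * n%:R.
have sphi k : smooth (phi_ k) by case: (tphi k).
have gE k x : g k x = (phi_ k x - excess x) ^+ 2 +
    \sum_i (partial i (phi_ k) x - Glog delta x ord0 i) ^+ 2.
  rewrite /g enorm_sqr dot_sqr; congr (_ + _); apply: eq_bigr => i _.
  by rewrite mxE [X in _ + X]mxE /grad mxE.
have four (a b : R) x : x != 0 -> `|a| <= (enorm x)^-1 -> `|b| <= (enorm x)^-1 ->
    (a - b) ^+ 2 <= 4 / enorm x ^+ 2.
  move=> x0 ha hb; rewrite -real_normK ?num_real// (_ : 4 / _ = (2 * (enorm x)^-1) ^+ 2); last first.
    by rewrite exprMn exprVn; congr (_ * _); rewrite -natrX.
  rewrite lerXn2r ?nnegrE ?mulr_ge0 ?invr_ge0 ?enorm_ge0// (le_trans (ler_normB _ _))//.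
  by rewrite mulr_natl mulr2n lerD.
have mg k : measurable_fun B (g k).
  rewrite (_ : g k = fun x => (phi_ k x - excess x) ^+ 2 +
    \sum_i (partial i (phi_ k) x - Glog delta x ord0 i) ^+ 2); last exact/funext/gE.
  apply: measurable_funD.
    apply: measurable_funX; apply: measurable_funB.
      by apply: measurable_funTS; apply: continuous_measurable_row; exact: smooth_continuous.
    apply: measurable_fun_punctured; first exact: open_eball.
    by move=> x xB x0; exact: continuous_excess.
  apply: measurable_sum => i; apply: measurable_funX; apply: measurable_funB.
    by apply: measurable_funTS; apply: continuous_measurable_row; exact: smooth_partial_continuous.
  exact: measurable_Glog.
have iC : mu.-integrable B (fun x => (C / enorm x ^+ 2)%:E).
  have i1 := integrable_inv_enorm_sqr n3 (ltW (@expRN1_lt1 R)).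
  have := integrableZl mB C i1; apply: eq_integrable => //.
have ae0 (P : 'rV[R]_n -> Prop) : (forall x, x != 0 -> P x) -> {ae mu, forall x, P x}.
  move=> HP; apply: (@ae_neq _ _ _ _ (0 : 'rV[R]_n)).
  - exact: measurable_row_set1.
  - by apply: lebesgue_row_set0; exact: leq_trans n3.
  - by move=> x /eqP; exact: HP.
have [_ _] : [/\ mu.-integrable B (cst 0%E),
    (fun k => \int[mu]_(x in B) `|(g k x)%:E - 0|)%E @ \oo --> 0%E &
    (fun k => \int[mu]_(x in B) (g k x)%:E)%E @ \oo --> (\int[mu]_(x in B) 0)%E].
  apply: (dominated_convergence mB _ _ _ iC).
  - by move=> k; apply/measurable_EFinP; exact: mg.
  - exact: measurable_cst.
  - apply: ae0 => x x0 xB; apply: cvg_EFin; first exact: nearW.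
    rewrite (_ : fine \o _ = g ^~ x); last by apply/funext.
    have [cphi cpart] := approx_cvg xB x0.
    rewrite (_ : g ^~ x = fun k => (phi_ k x - excess x) ^+ 2 +
      \sum_i (partial i (phi_ k) x - Glog delta x ord0 i) ^+ 2); last by apply/funext => k.
    have c0 (a : nat -> R) (b : R) : a k @[k --> \oo] --> b ->
        (a k - b) ^+ 2 @[k --> \oo] --> (0 : R).
      move=> ab; have z : a k - b @[k --> \oo] --> (0 : R).
        by rewrite -(subrr b); apply: cvgB => //; exact: cvg_cst.
      rewrite -[X in _ --> X](mul0r 0).
      rewrite (_ : (fun k => _) = (fun k => (a k - b) * (a k - b))); first exact: cvgM.
      by apply/funext => k; rewrite expr2.
    rewrite -[X in _ --> X]addr0; apply: cvgD; first exact: c0.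
    rewrite (_ : (fun k => _) =
        \sum_(i < n) (fun k => (partial i (phi_ k) x - Glog delta x ord0 i) ^+ 2)); last first.
      by apply/funext => k; rewrite fct_sumE.
    elim/big_ind : _ => [|f1 f2 h1 h2|i _]; first exact: cvg_cst.
      by rewrite -[X in _ --> X]addr0; exact: cvgD.
    by apply: c0; exact: cpart.
  - apply: ae0 => x x0 k xB /=; rewrite lee_fin gE ger0_norm; last first.
      by rewrite addr_ge0 ?sqr_ge0// sumr_ge0// => i _; exact: sqr_ge0.
    rewrite /C mulrDl lerD//.
      have k1 : 0 < k.+1%:R^-1 :> R by rewrite invr_gt0.
      have /andP[a0 a1] := approx_le d01 k1 (ltr0Sn R k) x0.
      have /andP[b0 b1] := excess_itv xB x0.
      by apply: four => //; rewrite ger0_norm.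
    rewrite -mulrA mulrCA mulr_natl -[X in _ *+ X]card_ord -sumr_const ler_sum// => i _.
    apply: four => //; last exact: Glog_coord_le.
    by apply: approx_partial_le => //; rewrite invr_gt0.
rewrite integral0 => /fine_cvgP[fin].
move=> /cvgrPdist_lt/(_ e e0) => small.
have [k [fk sk]] : exists k, (\int[mu]_(x in B) (g k x)%:E)%E \is a fin_num /\
    fine (\int[mu]_(x in B) (g k x)%:E)%E < e.
  near \oo => k; exists k; split; first by near: k.
  have : `|0 - fine (\int[mu]_(x in B) (g k x)%:E)%E| < e by near: k.
  by rewrite sub0r normrN; apply: le_lt_trans; exact: ler_norm.
exists (phi_ k); first exact: tphi.
by rewrite -[X in (X < _)%E](fineK fk) lte_fin.
Unshelve. all: by end_near. Qed.

Lemma bounded_on_boundary_u_log : bounded_on_boundary B (@u_log R n delta).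
Proof. by exists 1; exact: W12_0_excess. Qed.

End boundary_values.

(** * Failure of the three estimates *)

Section failure_of_estimates.
Context {R : realType} {n : nat}.
Hypothesis n3 : (3 <= n)%N.
Implicit Types (delta : R).
Local Notation mu := (@lebesgue_row R n).
Local Notation B := (eball (expR (-1)) : set 'rV[R]_n).

Lemma eball_min (r : R) (x : 'rV[R]_n) :
  enorm x < Num.min r (expR (-1)) -> enorm x < r /\ B x.
Proof. by rewrite lt_min => /andP[]. Qed.

Lemma u_log_not_ae0 delta (r : R) : 0 < r ->
  ~ {ae mu, forall x : 'rV[R]_n, enorm x < r -> u_log delta x = 0}.
Proof.
move=> r0 H; have m0 : 0 < Num.min r (expR (-1)) by rewrite lt_min r0 expR_gt0.
have [x [/eball_min[xr xB] x0 Px]] := ae_eball_exists n3 m0 H.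
by have := u_log_gt0 delta xB x0; rewrite Px// ltxx.
Qed.

Lemma u_log_unbounded_near0 delta (r M : R) : 0 < delta -> 0 < r ->
  ~ {ae mu, forall x : 'rV[R]_n, B x /\ enorm x < r -> u_log delta x <= M}.
Proof.
move=> d0 r0 H; have [s /andP[s0 sB] sP] := @u_log_gt_near0 R n delta M d0.
have m0 : 0 < Num.min r s by rewrite lt_min r0.
have [x [+ x0 Px]] := ae_eball_exists n3 m0 H.
rewrite lt_min => /andP[xr xs].
have := sP x x0 xs; rewrite ltNge Px//; split => //.
exact: lt_le_trans sB.
Qed.

Lemma u_log_not_bounded_above delta : 0 < delta -> ~ bounded_above B (u_log delta).
Proof.
move=> d0 [M H]; apply: (@u_log_unbounded_near0 delta 1 M d0 ltr01).
by apply: filterS H => x Px [xB _]; exact: Px.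
Qed.

Lemma u_log_not_locally_bounded_above delta : 0 < delta ->
  ~ locally_bounded_above B (u_log delta).
Proof.
move=> d0 /(_ 0)[|r r0 [M H]]; first by rewrite /eball/= enorm0 expR_gt0.
apply: (@u_log_unbounded_near0 delta r M d0 r0).
by apply: filterS H => x Px [xB xr]; apply: Px; split => //=; rewrite subr0.
Qed.

Lemma ess_inf_u_log delta (r : R) : delta < 0 -> 0 < r ->
  ess_inf_on (eball r) (@u_log R n delta) = 0%E.
Proof.
move=> d0 r0; apply/eqP; rewrite eq_le; apply/andP; split; last first.
  apply: ereal_sup_ubound => /=; apply: aeW => x _.
  by rewrite lee_fin powR_ge0.
apply: ge_ereal_sup => y /= H; rewrite leNgt; apply/negP => y0.
have [e e0 ey] : exists2 e : R, 0 < e & (e%:E <= y)%E.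
  case: y y0 {H} => [y|_|//]; last by exists 1 => //; rewrite leey.
  by rewrite lte_fin => y0; exists y.
have [s /andP[s0 _] sP] := @u_log_lt_near0 R n delta e d0 e0.
have m0 : 0 < Num.min r s by rewrite lt_min r0.
have [x [+ x0 Px]] := ae_eball_exists n3 m0 H.
rewrite lt_min => /andP[xr xs].
by have := le_trans ey (Px xr); rewrite lee_fin leNgt sP.
Qed.

(** The essential infimum is 0, so the right side is 0 for every [C], while the mean on the left is
    positive: a zero integral would make [u] vanish almost everywhere. *)
Lemma u_log_not_reverse_moser delta (a C r : R) : delta < 0 -> 0 < a ->
  0 < r <= expR (-1) -> ~ reverse_moser a C r (@u_log R n delta).
Proof.
move=> d0 a0 /andP[r0 rB]; rewrite /reverse_moser ess_inf_u_log ?divr_gt0// mule0.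
have mr := @measurable_eball R n r.
have sB : eball r `<=` B by move=> x xr; exact: lt_le_trans rB.
apply/negP; rewrite -ltNge; apply: poweR_gt0; apply: mule_gt0.
  by rewrite lte_fin invr_gt0 fine_gt0// eball_gt0// ltey_eq eball_fin_num.
rewrite lt0e integral_ge0 ?andbT; last by move=> x _; rewrite lee_fin powR_ge0.
apply/eqP => I0.
have mf : measurable_fun (eball r) (fun x : 'rV[R]_n => (u_log delta x `^ a)%:E).
  apply/measurable_EFinP; apply: (@measurableT_comp _ _ _ _ _ _ (fun y => y `^ a)).
    exact: measurable_powR.
  by apply: measurable_funS (measurable_u_log delta) => //; exact: measurable_eball.
have /(ae_eq_integral_abs mu mr mf)H :
    (\int[mu]_(x in eball r) `|(u_log delta x `^ a)%:E| = 0)%E.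
  by rewrite -I0; apply: eq_integral => x _; rewrite gee0_abs// lee_fin powR_ge0.
have [x [xr x0 Px]] := ae_eball_exists n3 r0 H.
have [/eqP] := Px xr; rewrite gt_eqF// powR_gt0//.
by apply: u_log_gt0 => //; exact: sB.
Qed.

Lemma small_exponent (C eps : R) : 0 < C -> 0 < eps ->
  exists2 delta : R, 0 < delta < 1 & delta * C < eps.
Proof.
move=> C0 e0; exists (Num.min 2^-1 (eps / (2 * C))).
  rewrite lt_min invr_gt0 ltr0n divr_gt0 ?mulr_gt0//=.
  by rewrite (@le_lt_trans _ _ 2^-1) ?ge_min ?lexx// invf_lt1 ?ltr1n.
rewrite -ltr_pdivlMr//; apply: (@le_lt_trans _ _ (eps / (2 * C))).
  by rewrite ge_min lexx orbT.
by rewrite ltr_pM2l// ltf_pV2 ?posrE ?mulr_gt0// ltr_pMl// ltr1n.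
Qed.

Lemma weak_solution_sub (Omega : set 'rV[R]_n) b d u :
  weak_solution Omega b d u -> weak_subsolution Omega b d u.
Proof.
by move=> [G HG H]; exists G => // phi /H[ih Ih] _; split => //; rewrite Ih.
Qed.

Lemma weak_solution_super (Omega : set 'rV[R]_n) b d u :
  weak_solution Omega b d u -> weak_supersolution Omega b d u.
Proof.
by move=> [G HG H]; exists G => // phi /H[ih Ih] _; split => //; rewrite Ih.
Qed.

End failure_of_estimates.

Theorem mainTheorem16 (R : realType) (n : nat) (n_ge3 : (3 <= n)%N) :
  let B := eball (expR (-1)) : set 'rV[R]_n in
  let zero_b := (fun=> 0) : 'rV[R]_n -> 'rV[R]_n in
  let zero_d := (fun=> 0) : 'rV[R]_n -> R in
  (forall delta : R, -1 < delta < 1 ->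
    [/\ W12 B (u_log delta),
        forall q : \bar R, (1 < q)%E ->
          in_lorentz_vec n%:R q B (b_log delta) /\
          in_lorentz (n%:R / 2) q B (d_log delta),
        weak_solution B (b_log delta) zero_d (u_log delta) /\
          weak_solution B zero_b (d_log delta) (u_log delta),
        forall x : 'rV[R]_n, enorm x = expR (-1) -> u_log delta x = 1 &
        (0 < delta -> u_log delta x @[x --> (0 : 'rV[R]_n)^'] --> +oo) /\
        (delta < 0 ->
          u_log delta x @[x --> (0 : 'rV[R]_n)^'] --> (0 : R) /\
          forall r : R, 0 < r ->
            ~ {ae @lebesgue_row R n, forall x, enorm x < r -> u_log delta x = 0})])
  /\
  (forall (q : \bar R) (eps : R), (1 < q)%E -> 0 < eps ->
    (* the operator - Delta u - div (b u) *)
    [/\ exists b : 'rV[R]_n -> 'rV[R]_n,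
          [/\ in_lorentz_vec n%:R q B b,
              (lorentz_norm n%:R q B (enorm \o b) < eps%:E)%E &
              exists u, [/\ weak_subsolution B b zero_d u,
                bounded_on_boundary B u & ~ bounded_above B u]],
        exists b : 'rV[R]_n -> 'rV[R]_n,
          [/\ in_lorentz_vec n%:R q B b,
              (lorentz_norm n%:R q B (enorm \o b) < eps%:E)%E &
              exists u, weak_subsolution B b zero_d u /\
                ~ locally_bounded_above B u] &
        exists b : 'rV[R]_n -> 'rV[R]_n,
          [/\ in_lorentz_vec n%:R q B b,
              (lorentz_norm n%:R q B (enorm \o b) < eps%:E)%E &
              exists u, [/\ weak_supersolution B b zero_d u,
                forall x, B x -> 0 <= u x &
                forall a C r : R, 0 < a -> 0 < r <= expR (-1) ->
                  ~ reverse_moser a C r u]]] /\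
    (* the operator - Delta u + d u *)
    [/\ exists d : 'rV[R]_n -> R,
          [/\ in_lorentz (n%:R / 2) q B d,
              (lorentz_norm (n%:R / 2) q B d < eps%:E)%E &
              exists u, [/\ weak_subsolution B zero_b d u,
                bounded_on_boundary B u & ~ bounded_above B u]],
        exists d : 'rV[R]_n -> R,
          [/\ in_lorentz (n%:R / 2) q B d,
              (lorentz_norm (n%:R / 2) q B d < eps%:E)%E &
              exists u, weak_subsolution B zero_b d u /\
                ~ locally_bounded_above B u] &
        exists d : 'rV[R]_n -> R,
          [/\ in_lorentz (n%:R / 2) q B d,
              (lorentz_norm (n%:R / 2) q B d < eps%:E)%E &
              exists u, [/\ weak_supersolution B zero_b d u,
                forall x, B x -> 0 <= u x &
                forall a C r : R, 0 < a -> 0 < r <= expR (-1) ->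
                  ~ reverse_moser a C r u]]]).
Proof.
move=> B zero_b zero_d; split=> [delta d1|q eps q1 eps0].
  have dA : `|delta| <= 1 by case/andP: d1 => ? ?; rewrite ler_norml; apply/andP; split; exact: ltW.
  split.
  - by exists (Glog delta); exact: W12_grad_u_log.
  (* Only membership is wanted for a given [delta], so the crude choice [A = 1] is enough. *)
  - move=> q q1; have [C _ HC] := @lorentz_b_log_small R n n_ge3 q q1.
    have [D _ HD] := @lorentz_d_log_small R n n_ge3 q q1.
    by split; [have [] := HC delta 1 ltr01 dA|have [] := HD delta 1 d1 ltr01 dA].
  - by split; [exact: weak_solution_b_log|exact: weak_solution_d_log].
  - by move=> x; exact: u_log_boundary.
  - split=> [d0|d0]; first exact: u_log_cvgy.
    by split; [exact: u_log_cvg0|move=> r r0; exact: u_log_not_ae0].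
have [C C0 HC] := @lorentz_b_log_small R n n_ge3 q q1.
have [D D0 HD] := @lorentz_d_log_small R n n_ge3 q q1.
(* The Lorentz bounds depend on [delta] only through its absolute value, so one small number per
   operator serves with both signs. *)
have [db db01 dbC] := small_exponent C0 eps0.
have [dd dd01 ddD] := small_exponent D0 eps0.
have pos t : 0 < t < 1 -> 0 < t :> R by case/andP.
have pm (t : R) : 0 < t < 1 -> [/\ -1 < t < 1, -1 < - t < 1, - t < 0, `|t| <= t & `|- t| <= t].
  by move=> /andP[t0 t1]; rewrite normrN gtr0_norm//; split => //; lra.
have [b1 b2 b3 b4 b5] := pm db db01; have [e1 e2 e3 e4 e5] := pm dd dd01.
have [hb nb] := HC db db (pos _ db01) b4.
have [hb' nb'] := HC (- db) db (pos _ db01) b5.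
have [hd nd] := HD dd dd e1 (pos _ dd01) e4.
have [hd' nd'] := HD (- dd) dd e2 (pos _ dd01) e5.
have lt_eps (x : \bar R) (y : R) : (x <= y%:E)%E -> y < eps -> (x < eps%:E)%E.
  by move=> xy ye; rewrite (le_lt_trans xy)// lte_fin.
split; split.
- exists (b_log db); split; [exact: hb|exact: lt_eps nb dbC|].
  exists (u_log db); split.
  + exact/weak_solution_sub/weak_solution_b_log.
  + exact: bounded_on_boundary_u_log.
  + exact: u_log_not_bounded_above (pos _ db01).
- exists (b_log db); split; [exact: hb|exact: lt_eps nb dbC|].
  exists (u_log db); split; first exact/weak_solution_sub/weak_solution_b_log.
  exact: u_log_not_locally_bounded_above (pos _ db01).
- exists (b_log (- db)); split; [exact: hb'|exact: lt_eps nb' dbC|].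
  exists (u_log (- db)); split.
  + exact/weak_solution_super/weak_solution_b_log.
  + by move=> x _; exact: powR_ge0.
  + by move=> a c r a0 r0; exact: u_log_not_reverse_moser.
- exists (d_log dd); split; [exact: hd|exact: lt_eps nd ddD|].
  exists (u_log dd); split.
  + exact/weak_solution_sub/weak_solution_d_log.
  + exact: bounded_on_boundary_u_log.
  + exact: u_log_not_bounded_above (pos _ dd01).
- exists (d_log dd); split; [exact: hd|exact: lt_eps nd ddD|].
  exists (u_log dd); split; first exact/weak_solution_sub/weak_solution_d_log.
  exact: u_log_not_locally_bounded_above (pos _ dd01).
- exists (d_log (- dd)); split; [exact: hd'|exact: lt_eps nd' ddD|].
  exists (u_log (- dd)); split.
  + exact/weak_solution_super/weak_solution_d_log.
  + by move=> x _; exact: powR_ge0.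
  + by move=> a c r a0 r0; exact: u_log_not_reverse_moser.
Qed.
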